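(* Let $\mathbb D(\cdot\|\cdot)$ be a lower-semicontinuous quantum divergence with the direct-sum property. Let $A,B,E$ be quantum systems, $\mathcal N\in\mathrm{CPTP}(AE:B)$, $\mathcal M\in\mathrm{CP}(AE:B)$, and let $n\ge2$ be an integer. For $\rho\in\mathscr D(\mathcal H_A^{\otimes n})$ and $\sigma,\omega\in\mathscr D(\mathcal H_E^{\otimes n})$ write $$F(\rho,\sigma,\omega)=\mathbb D\Big(\mathcal N_{AE\to B}^{\otimes n}\big(|\rho\rangle\langle\rho|_{A_1^nR_1^n}\otimes\sigma_{E_1^n}\big)\Big\|\mathcal M_{AE\to B}^{\otimes n}\big(|\rho\rangle\langle\rho|_{A_1^nR_1^n}\otimes\omega_{E_1^n}\big)\Big),$$ where $|\rho\rangle_{A_1^nR_1^n}$ is a purification of $\rho$ with $\mathcal H_R=\mathcal H_A$. Then $$\mathbb D^{\mathrm{mx}}\big(\mathcal N_{AE\to B}^{\otimes n}\big\|\mathcal M_{AE\to B}^{\otimes n}\big)=\inf_{\sigma,\omega\in\mathrm{PERM}(\mathcal H_E^{\otimes n})}\ \sup_{\rho\in\mathscr D(\mathcal H_A^{\otimes n})}F(\rho,\sigma,\omega)=\inf_{\sigma,\omega\in\mathrm{PERM}(\mathcal H_E^{\otimes n})}\ \sup_{\rho\in\mathrm{PERM}(\mathcal H_A^{\otimes n})}F(\rho,\sigma,\omega).$$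
   Context: All quantum systems have finite-dimensional Hilbert spaces. $\mathscr D(\mathcal H)$ is the set of density operators on $\mathcal H$. $\mathrm{CPTP}(AE:B)$ (resp. $\mathrm{CP}(AE:B)$) is the set of completely positive trace-preserving (resp. completely positive) linear maps from operators on $\mathcal H_A\otimes\mathcal H_E$ to operators on $\mathcal H_B$. Such a map applied to an operator also involving a reference system $R$ acts as the identity on $R$. $A_1^n=A_1\cdots A_n$ denotes $n$ copies of $A$ (similarly $E_1^n,R_1^n,B_1^n$). $\mathrm{PERM}(\mathcal H^{\otimes n})$ is the set of permutation-invariant density operators on $\mathcal H^{\otimes n}$: those $\tau\in\mathscr D(\mathcal H^{\otimes n})$ with $U_\pi\tau U_\pi^\dagger=\tau$ for all $\pi$ in the symmetric group $S_n$, where $U_\pi$ is the unitary $|\psi_1\rangle\otimes\cdots\otimes|\psi_n\rangle\mapsto|\psi_{\pi(1)}\rangle\otimes\cdots\otimes|\psi_{\pi(n)}\rangle$. A quantum divergence is a functional $\mathbb D(\rho\|\sigma)\in\mathbb R\cup\{+\infty\}$, defined for all density operators $\rho$ and positive semidefinite operators $\sigma$ on a common (arbitrary finite-dimensional) Hilbert space, satisfying the data-processing inequality $\mathbb D(\mathcal E(\rho)\|\mathcal E(\sigma))\le\mathbb D(\rho\|\sigma)$ for every CPTP map $\mathcal E$. It has the direct-sum property if for every finite probability distribution $(p(x))_x$, density operators $\rho^{(x)}$ and positive semidefinite operators $\sigma^{(x)}$, with $\{|x\rangle\}$ an orthonormal basis, $$\mathbb D\Big(\sum_x p(x)|x\rangle\langle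 x|\otimes\rho^{(x)}\Big\|\sum_x p(x)|x\rangle\langle x|\otimes\sigma^{(x)}\Big)=\sum_x p(x)\,\mathbb D(\rho^{(x)}\|\sigma^{(x)}).$$ Lower semicontinuity means joint lower semicontinuity of $(\rho,\sigma)\mapsto\mathbb D(\rho\|\sigma)$ on each finite-dimensional space. Minimax channel divergence: for $\mathcal N\in\mathrm{CPTP}(AE:B)$, $\mathcal M\in\mathrm{CP}(AE:B)$, $$\mathbb D^{\mathrm{mx}}(\mathcal N_{AE\to B}\|\mathcal M_{AE\to B})=\sup_{\rho_{AR}\in\mathscr D(\mathcal H_A\otimes\mathcal H_R)}\ \inf_{\sigma_E,\omega_E\in\mathscr D(\mathcal H_E)}\mathbb D\big(\mathcal N_{AE\to B}(\rho_{AR}\otimes\sigma_E)\big\|\mathcal M_{AE\to B}(\rho_{AR}\otimes\omega_E)\big),$$ with $R$ a reference system of arbitrary dimension (also optimized over). For $\mathcal N^{\otimes n},\mathcal M^{\otimes n}$ it is applied with $A_1^n,E_1^n,B_1^n$ in place of $A,E,B$. *)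

(* Defs.v *)
From HB Require Import structures.
From mathcomp Require Import all_boot all_order all_algebra all_fingroup.
From mathcomp Require Import complex.
From mathcomp Require Import all_classical all_reals all_analysis.

Set Implicit Arguments.
Unset Strict Implicit.
Unset Printing Implicit Defensive.

Import Order.TTheory GRing.Theory Num.Theory.
Import numFieldNormedType.Exports.
Local Open Scope classical_set_scope.
Local Open Scope ring_scope.
Local Open Scope sesquilinear_scope.

(* R[i] as a numClosedFieldType: the norm topology, hence the topology on
   matrices, is inferred from this structure. *)
Definition Cplx (R : realType) : numClosedFieldType := R[i].

(* A quantum system is given by the finite set I labelling an orthonormal basis
   of its Hilbert space. Its dimension is #|I|, operators are #|I| x #|I|
   matrices, the tensor product of systems is the product of label sets, and
   the reindexing between I and 'I_#|I| is always enum_rank / enum_val. *)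
Notation op R I := 'M[Cplx R]_#|{: I}|.
Notation ket R I := 'cV[Cplx R]_#|{: I}|.

Definition copies (n : nat) (I : finType) : finType := {ffun 'I_n -> I}.

Section Operators.
Variable R : realType.

Definition ent (I : finType) (X : op R I) (i j : I) : Cplx R :=
  X (enum_rank i) (enum_rank j).

Definition mkop (I : finType) (f : I -> I -> Cplx R) : op R I :=
  \matrix_(i, j) f (enum_val i) (enum_val j).

Definition ketbra (I : finType) (i j : I) : op R I :=
  delta_mx (enum_rank i) (enum_rank j).

Definition tens (I J : finType) (X : op R I) (Y : op R J) :
    op R (I * J)%type :=
  mkop (fun p q => ent X p.1 q.1 * ent Y p.2 q.2).

Definition ptrace2 (I J : finType) (X : op R (I * J)%type) : op R I :=
  mkop (fun i i' => \sum_(j : J) ent X (i, j) (i', j)).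

(* 0 <= z in R[i] says that z is a nonnegative real, so this implies that X is
   Hermitian. *)
Definition psd (I : finType) : set (op R I) :=
  [set X | forall v : ket R I, 0 <= (v^t* *m X *m v) 0 0].

Definition density (I : finType) : set (op R I) :=
  [set X | psd X /\ \tr X = 1].

Definition projector (I : finType) (v : ket R I) : op R I := v *m v^t*.

Definition purifies (I J : finType) (v : ket R (I * J)%type)
    (rho : op R I) : Prop :=
  ptrace2 (projector v) = rho.

(* U_pi |x_1 ... x_n> = |x_pi(1) ... x_pi(n)> on basis vectors *)
Definition perm_unitary (n : nat) (I : finType) (pi : 'S_n) :
    op R (copies n I) :=
  mkop (fun (y x : copies n I) => (y == [ffun k => x (pi k)])%:R).

Definition PERM (n : nat) (I : finType) : set (op R (copies n I)) :=
  [set tau | density tau /\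
     forall pi : 'S_n,
       perm_unitary I pi *m tau *m (perm_unitary I pi)^t* = tau].

(* Phi \otimes id_K, computed block by block *)
Definition ampl (I J K : finType) (Phi : op R I -> op R J)
    (X : op R (I * K)%type) : op R (J * K)%type :=
  mkop (fun p q =>
    ent (Phi (mkop (fun i i' => ent X (i, p.2) (i', q.2)))) p.1 q.1).

Definition CP (I J : finType) (Phi : op R I -> op R J) : Prop :=
  linear Phi /\
  forall (K : finType) (X : op R (I * K)%type), psd X -> psd (ampl Phi X).

Definition CPTP (I J : finType) (Phi : op R I -> op R J) : Prop :=
  CP Phi /\ forall X : op R I, \tr (Phi X) = \tr X.

(* Phi^{\otimes n}, with input factors regrouped from (AE)^n into A^n E^n:
   sum over p, q of X_(p,q) times the tensor product over k of
   Phi(|p_k><q_k|), where p_k = (a_k, e_k). *)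
Definition tensor_pow (n : nat) (A E B : finType)
    (Phi : op R (A * E)%type -> op R B)
    (X : op R (copies n A * copies n E)%type) : op R (copies n B) :=
  mkop (fun b b' : copies n B =>
    \sum_(p : (copies n A * copies n E)%type)
    \sum_(q : (copies n A * copies n E)%type)
      ent X p q *
      \prod_(k < n)
        ent (Phi (ketbra (p.1 k, p.2 k) (q.1 k, q.2 k))) (b k) (b' k)).

(* rho_{AK} \otimes sigma_E, with factors listed in the order A E K *)
Definition joint_input (A E K : finType) (rho : op R (A * K)%type)
    (sigma : op R E) : op R ((A * E) * K)%type :=
  mkop (fun p q =>
    ent rho (p.1.1, p.2) (q.1.1, q.2) * ent sigma p.1.2 q.1.2).

(* Phi_{AE -> B}(rho_{AK} \otimes sigma_E), an operator on B K *)
Definition output (A E B K : finType) (Phi : op R (A * E)%type -> op R B)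
    (rho : op R (A * K)%type) (sigma : op R E) : op R (B * K)%type :=
  ampl Phi (joint_input rho sigma).

End Operators.

Section Divergence.
Variable R : realType.

(* A family indexed by the underlying space; only its values at a density
   operator and a positive semidefinite operator are meaningful. *)
Definition functional := forall I : finType, op R I -> op R I -> \bar R.

Definition divergence_domain (I : finType) : set (op R I * op R I) :=
  @density R I `*` @psd R I.

Definition quantum_divergence (D : functional) : Prop :=
  (forall (I : finType) (rho sigma : op R I),
     density rho -> psd sigma -> D I rho sigma != -oo%E) /\
  (forall (I J : finType) (Phi : op R I -> op R J) (rho sigma : op R I),
     CPTP Phi -> density rho -> psd sigma ->
     (D J (Phi rho) (Phi sigma) <= D I rho sigma)%E).

Definition classical_quantum (X I : finType) (p : X -> R)
    (rho : X -> op R I) : op R (X * I)%type :=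
  \sum_(x : X) ((p x)%:C%C : Cplx R) *: tens (ketbra R x x) (rho x).

(* In \bar R, 0 * +oo = 0. *)
Definition direct_sum_property (D : functional) : Prop :=
  forall (X I : finType) (p : X -> R) (rho sigma : X -> op R I),
    (forall x, 0 <= p x) -> \sum_(x : X) p x = 1 ->
    (forall x, density (rho x)) -> (forall x, psd (sigma x)) ->
    D _ (classical_quantum p rho) (classical_quantum p sigma) =
    (\sum_(x : X) (p x)%:E * D I (rho x) (sigma x))%E.

(* joint lower semicontinuity for the relative topology of the domain *)
Definition lsc_divergence (D : functional) : Prop :=
  forall I : finType,
    lower_semicontinuous
      (fun x : subspace (@divergence_domain I) => D I x.1 x.2).

Definition minimax_divergence (D : functional) (A E B : finType)
    (N M : op R (A * E)%type -> op R B) : \bar R :=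
  ereal_sup [set x | exists (K : finType) (rho : op R (A * K)%type),
    density rho /\
    x = ereal_inf [set D _ (output N rho sigma) (output M rho omega)
                  | sigma in @density R E & omega in @density R E]].

End Divergence.

(* Main.v *)
(* D^mx is sup_rho inf_(sigma, omega) F: by data processing only the reduced
   state of rho_AR matters, since any extension of rho_A is obtained from a
   purification by a channel on the reference system. The direct-sum property
   together with data processing makes F concave in rho (flag the pieces of a
   mixture in the reference system) and jointly convex in (sigma, omega) (forget
   a classical flag), so Fan's minimax theorem, whose compactness and lower
   semicontinuity hypotheses hold for density operators, exchanges sup and inf.
   Finally F is invariant under simultaneous permutation of its three arguments,
   so averaging over S_n decreases the sup over rho when applied to
   (sigma, omega), and increases F when applied to rho, for invariant sigma and
   omega. *)

Require Import Defs.
From mathcomp Require Import all_boot all_order all_algebra all_fingroup.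
From mathcomp Require Import complex ring lra.
From mathcomp Require Import all_classical all_reals all_analysis.
Import Order.TTheory GRing.Theory Num.Theory.
Import numFieldNormedType.Exports.
Local Open Scope classical_set_scope.
Local Open Scope ring_scope.
Local Open Scope sesquilinear_scope.

Set Implicit Arguments.
Unset Strict Implicit.
Unset Printing Implicit Defensive.

(** * Positive matrices *)

(** Two obstacles shape the proof. Since [D] may be [+oo], the minimax theorem is proved for
    functions with values in [\bar R]. A finite family is handled by minimizing a smooth penalty
    over its epigraph, where real heights stand in for possibly infinite values. The weights of the
    mixture are the gradient of the penalty, pushed away from zero because [0 * +oo = 0] would let a
    zero weight hide an infinite value. The other obstacle is that [purif] is an arbitrary choice,
    compatible neither with mixtures nor with permutations. Each argument is therefore made for
    arbitrary extensions, with [Dout], and carried to [Fout] by the inequality that a purification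
    dominates every extension of its reduced state. This direction suffices throughout. Complete
    positivity is used through Kraus operators: they multiply under tensor powers, and they reduce
    positivity to exhibiting Gram factors. *)

Section AdjointMatrices.
Variable C : numClosedFieldType.

Lemma adjmxM m n p (X : 'M[C]_(m, n)) (Y : 'M[C]_(n, p)) :
  (X *m Y)^t* = Y^t* *m X^t*.
Proof. by rewrite trmx_mul map_mxM. Qed.

Lemma adjmxB m n (X Y : 'M[C]_(m, n)) : (X - Y)^t* = X^t* - Y^t*.
Proof. by rewrite linearB /= map_mxB. Qed.

Lemma adjmx1 n : (1%:M : 'M[C]_n)^t* = 1%:M.
Proof. by rewrite trmx1 map_mx1. Qed.

Lemma mulmx_adj_eq0 m n (X : 'M[C]_(m, n)) : X *m X^t* = 0 -> X = 0.
Proof.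
move=> X0; apply/matrixP => i j; rewrite mxE; apply/eqP.
have /matrixP /(_ i i) := X0; rewrite !mxE.
under eq_bigr do rewrite !mxE -normCK.
move=> /psumr_eq0P /= => /(_ (fun j _ => exprn_ge0 2 (normr_ge0 (X i j)))).
by move=> /(_ j isT) /eqP; rewrite expf_eq0 normr_eq0.
Qed.

Lemma hermitian_spectral n (X : 'M[C]_n) : X = X^t* ->
  exists (S : 'M[C]_n) (d : 'rV[C]_n),
    [/\ S \is unitarymx, forall j, d 0 j \is Num.real
      & X = S^t* *m diag_mx d *m S].
Proof.
move=> Xh.
have Xherm : X \is hermsymmx by apply/is_hermitianmxP; rewrite expr0 scale1r.
have /orthomx_spectralP := hermitian_normalmx Xherm.
have /mxOverP dreal := hermitian_spectral_diag_real Xherm.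
have Su := spectral_unitarymx X; rewrite (invmx_unitary Su) => XE.
by exists (spectralmx X), (spectral_diag X).
Qed.

Lemma psdmx_factor n (X : 'M[C]_n) : X = X^t* ->
  (forall v : 'cV[C]_n, 0 <= (v^t* *m X *m v) 0 0) ->
  exists Y : 'M[C]_n, X = Y *m Y^t*.
Proof.
move=> /hermitian_spectral[S [d [Su _ XE]]] Xpsd.
have d_ge0 j : 0 <= d 0 j.
  (* The test vector is the [j]-th eigenvector, where the form takes the value [d 0 j]. *)
  have := Xpsd (col j (S^t*)); rewrite XE colE adjmxM trmxCK.
  rewrite !mulmxA -[_ *m S *m S^t*]mulmxA (unitarymxP Su) mulmx1.
  rewrite -[_ *m S *m S^t*]mulmxA (unitarymxP Su) mulmx1.
  have -> : (delta_mx j (0 : 'I_1))^t* = delta_mx 0 j :> 'rV[C]_n.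
    by rewrite trmx_delta map_delta_mx.
  by rewrite -rowE -colE !mxE eqxx.
exists (S^t* *m diag_mx (\row_j sqrtC (d 0 j))).
rewrite adjmxM trmxCK XE !mulmxA tr_diag_mx map_diag_mx -[in RHS](mulmxA (S^t*)).
rewrite mulmx_diag; congr (_ *m diag_mx _ *m _); apply/rowP => j; rewrite !mxE.
by rewrite /= (CrealP _) ?ger0_real ?sqrtC_ge0 // -expr2 sqrtCK.
Qed.

Lemma hermitian_ginv n (X : 'M[C]_n) : X = X^t* ->
  exists G : 'M[C]_n, [/\ G^t* = G, X *m G *m X = X & G *m X *m G = G].
Proof.
move=> /hermitian_spectral[S [d [Su dreal Xdiag]]].
have SS (Y : 'M[C]_n) : Y *m S *m S^t* = Y.
  by rewrite -mulmxA (unitarymxP Su) mulmx1.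
(* Since [0^-1 = 0], this inverts the nonzero eigenvalues and keeps the zero ones: [G] is the
   pseudoinverse. *)
pose e : 'rV[C]_n := \row_j (d 0 j)^-1.
have dd : diag_mx d *m diag_mx e *m diag_mx d = diag_mx d.
  rewrite !mulmx_diag; congr diag_mx; apply/rowP => j; rewrite !mxE.
  by have [->|dj0] := eqVneq (d 0 j) 0; rewrite ?mulr0 ?divfK.
have ee : diag_mx e *m diag_mx d *m diag_mx e = diag_mx e.
  rewrite !mulmx_diag; congr diag_mx; apply/rowP => j; rewrite !mxE.
  by have [->|dj0] := eqVneq (d 0 j) 0; rewrite ?invr0 ?mulr0 // mulVf ?mul1r.
exists (S^t* *m diag_mx e *m S); split.
- rewrite !adjmxM trmxCK tr_diag_mx map_diag_mx mulmxA; congr (_ *m diag_mx _ *m _).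
  by apply/rowP => j; rewrite !mxE fmorphV /= (CrealP (dreal j)).
- rewrite {1 2}Xdiag !mulmxA !SS; rewrite [in RHS]Xdiag.
  by rewrite -!(mulmxA (S^t*)) dd.
- by rewrite Xdiag !mulmxA !SS -!(mulmxA (S^t*)) ee.
Qed.

(* Two factorizations of the same positive matrix differ by a partial isometry
   [U] whose defect [P] is killed by the first factor. *)
Lemma gram_factor_unique m n p (V : 'M[C]_(m, n)) (W : 'M[C]_(m, p)) :
  V *m V^t* = W *m W^t* ->
  exists (U : 'M[C]_(n, p)) (P : 'M[C]_n),
    [/\ W = V *m U, V *m P = 0 & U *m U^t* + P *m P^t* = 1%:M].
Proof.
set X := V *m V^t* => VW.
have Xh : X = X^t* by rewrite /X adjmxM trmxCK.
have [G [Gh XGX GXG]] := hermitian_ginv Xh.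
(* The Gram matrix of [Y - X *m G *m Y] vanishes because [X *m G *m X = X]. *)
have absorb q (Y : 'M[C]_(m, q)) : Y *m Y^t* = X -> X *m G *m Y = Y.
  move=> YX; apply/eqP; rewrite eq_sym -subr_eq0; apply/eqP/mulmx_adj_eq0.
  rewrite -{1 3}[Y]mul1mx -mulmxBl adjmxM mulmxA -(mulmxA _ Y) YX.
  by rewrite mulmxBl mul1mx XGX subrr mul0mx.
have VG : X *m G *m V = V by exact: absorb.
(* [V^t* *m G *m V] is the orthogonal projector onto the range of [V^t*], so the second witness
   projects onto the kernel of [V]. *)
exists (V^t* *m G *m W), (1%:M - V^t* *m G *m V); split.
- by rewrite !mulmxA -/X absorb.
- by rewrite mulmxBr mulmx1 !mulmxA -/X VG subrr.
- have PP : V^t* *m G *m V *m (V^t* *m G *m V) = V^t* *m G *m V.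
    by rewrite -[in RHS]GXG /X !mulmxA.
  have -> : V^t* *m G *m W *m (V^t* *m G *m W)^t* = V^t* *m G *m V.
    by rewrite !adjmxM trmxCK Gh -[in RHS]GXG VW !mulmxA.
  rewrite adjmxB adjmx1 !adjmxM trmxCK Gh mulmxBr mulmx1 mulmxBl mul1mx.
  by rewrite !mulmxA in PP *; rewrite PP subrr subr0 subrKC.
Qed.

End AdjointMatrices.

(** * Entries and positivity of operators *)

Section Entries.
Variable R : realType.
Local Notation C := (Cplx R).

Lemma ent_mkop (I : finType) (f : I -> I -> C) i j : ent (mkop f) i j = f i j.
Proof. by rewrite /ent mxE !enum_rankK. Qed.

Lemma op_ext (I : finType) (X Y : op R I) :
  (forall i j, ent X i j = ent Y i j) -> X = Y.
Proof.
by move=> XY; apply/matrixP => i j; have := XY (enum_val i) (enum_val j);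
   rewrite /ent !enum_valK.
Qed.

Lemma entD (I : finType) (X Y : op R I) i j :
  ent (X + Y) i j = ent X i j + ent Y i j.
Proof. by rewrite /ent mxE. Qed.

Lemma entZ (I : finType) (a : C) (X : op R I) i j : ent (a *: X) i j = a * ent X i j.
Proof. by rewrite /ent mxE. Qed.

Lemma ent_sum (I S : finType) (X : S -> op R I) i j :
  ent (\sum_s X s) i j = \sum_s ent (X s) i j.
Proof. by rewrite /ent summxE. Qed.

Lemma sum_enum_rank (I : finType) (F : 'I_#|{: I}| -> C) :
  \sum_k F k = \sum_(i : I) F (enum_rank i).
Proof. by rewrite (reindex (@enum_rank I)) //; exact/onW_bij/enum_rank_bij. Qed.

Lemma ent_mulmx (I : finType) (X Y : op R I) i j :
  ent (X *m Y) i j = \sum_k ent X i k * ent Y k j.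
Proof. by rewrite /ent mxE sum_enum_rank. Qed.

Lemma ent_adj (I : finType) (X : op R I) i j : ent (X^t*) i j = (ent X j i)^*.
Proof. by rewrite /ent !mxE. Qed.

Lemma ent_ketbra (I : finType) (i j k l : I) :
  ent (ketbra R i j) k l = (k == i)%:R * (l == j)%:R.
Proof. by rewrite /ent mxE !(can_eq (@enum_rankK _)) -mulnb natrM. Qed.

Lemma mxtrace_ent (I : finType) (X : op R I) : \tr X = \sum_i ent X i i.
Proof. by rewrite /mxtrace sum_enum_rank. Qed.

Lemma sum_deltal (I : finType) (F : I -> C) k : \sum_i (i == k)%:R * F i = F k.
Proof.
rewrite (bigD1 k) //= eqxx mul1r big1 ?addr0 // => i /negPf->.
by rewrite mul0r.
Qed.

Lemma sum_deltar (I : finType) (F : I -> C) k : \sum_i F i * (i == k)%:R = F k.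
Proof. by under eq_bigr do rewrite mulrC; exact: sum_deltal. Qed.

Lemma mulr_sumlr (I J : finType) (F : I -> C) (G : J -> C) :
  (\sum_i F i) * (\sum_j G j) = \sum_i \sum_j F i * G j.
Proof. by rewrite mulr_suml; apply: eq_bigr => i _; rewrite mulr_sumr. Qed.

Lemma sum_pair (I J : finType) (F : I * J -> C) :
  \sum_p F p = \sum_i \sum_j F (i, j).
Proof. by rewrite pair_bigA; apply: eq_bigr => -[]. Qed.

Lemma op_sum_ketbra (I : finType) (X : op R I) :
  X = \sum_i \sum_j ent X i j *: ketbra R i j.
Proof.
apply: op_ext => i j; rewrite ent_sum.
under eq_bigr do rewrite ent_sum.
under eq_bigr do under eq_bigr do rewrite entZ ent_ketbra mulrCA eq_sym
  [ (j == _)]eq_sym.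
under eq_bigr do rewrite -mulr_sumr sum_deltar.
by rewrite sum_deltal.
Qed.

Lemma psdP (I : finType) (X : op R I) :
  psd X <-> forall f : I -> C, 0 <= \sum_i \sum_j (f i)^* * ent X i j * f j.
Proof.
have qform (v : ket R I) : (v^t* *m X *m v) 0 0 =
    \sum_i \sum_j (v (enum_rank i) 0)^* * ent X i j * v (enum_rank j) 0.
  rewrite mxE sum_enum_rank exchange_big; apply: eq_bigr => j _.
  by rewrite mxE sum_enum_rank mulr_suml; apply: eq_bigr => i _; rewrite !mxE.
split=> [Xpsd f|Xpsd v]; last by rewrite qform; exact: Xpsd.
have := Xpsd (\col_k f (enum_val k)); rewrite qform.
by under eq_bigr do under eq_bigr do rewrite !mxE !enum_rankK.
Qed.

(** The quadratic form is a sum of squared moduli over [T]. Leaving [T] free lets later positivity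
    claims be settled by a factor with a convenient index set; [psd_gram] is the converse. *)
Lemma gram_psd (I T : finType) (Y : I -> T -> C) (X : op R I) :
  (forall i j, ent X i j = \sum_t Y i t * (Y j t)^*) -> psd X.
Proof.
move=> XY; apply/psdP => f.
suff -> : \sum_i \sum_j (f i)^* * ent X i j * f j =
          \sum_t `|\sum_i (f i)^* * Y i t| ^+ 2.
  by apply: sumr_ge0 => t _; exact: exprn_ge0.
transitivity (\sum_t \sum_i \sum_j (f i)^* * Y i t * ((f j)^* * Y j t)^*); last first.
  by apply: eq_bigr => t _; rewrite normCK rmorph_sum mulr_sumlr.
rewrite [RHS]exchange_big; apply: eq_bigr => i _.
rewrite [RHS]exchange_big; apply: eq_bigr => j _.
rewrite XY mulr_sumr mulr_suml; apply: eq_bigr => t _.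
by rewrite rmorphM /= conjCK !mulrA; ring.
Qed.

(** Polarization: on vectors supported by [i] and [j] the form is real, and the coefficients
    [(1, 1)] and [(1, 'i)] make [ent X i j + ent X j i] real and [ent X i j - ent X j i]
    imaginary. *)
Lemma psd_conj (I : finType) (X : op R I) i j : psd X -> ent X j i = (ent X i j)^*.
Proof.
move=> /psdP Xpsd.
have sum2 (a b : C) (i0 j0 : I) (F : I -> C) :
    \sum_k (a * (k == i0)%:R + b * (k == j0)%:R) * F k = a * F i0 + b * F j0.
  under eq_bigr do rewrite mulrDl -!mulrA; rewrite big_split /=.
  by rewrite -!mulr_sumr !sum_deltal.
have quad (a b : C) :
    0 <= a^* * (ent X i i * a + ent X i j * b) + b^* * (ent X j i * a + ent X j j * b).
  have := Xpsd (fun k => a * (k == i)%:R + b * (k == j)%:R).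
  suff -> // : \sum_k \sum_l (a * (k == i)%:R + b * (k == j)%:R)^* * ent X k l *
      (a * (l == i)%:R + b * (l == j)%:R) =
      \sum_k (a^* * (k == i)%:R + b^* * (k == j)%:R) * (a * ent X k i + b * ent X k j).
    by rewrite sum2 // !(mulrC a) !(mulrC b).
  apply: eq_bigr => k _; rewrite -sum2 // mulr_sumr; apply: eq_bigr => l _.
  by rewrite rmorphD !rmorphM /= !conjC_nat -mulrA (mulrC (ent X k l)).
have diag k : ent X k k \is Num.real.
  apply: ger0_real; have := Xpsd (fun l => (l == k)%:R).
  under eq_bigr do under eq_bigr do rewrite /= conjC_nat.
  by under eq_bigr do rewrite sum_deltar; rewrite sum_deltal.
have cross (a b : C) : a^* * ent X i j * b + b^* * ent X j i * a \is Num.real.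
  have -> : a^* * ent X i j * b + b^* * ent X j i * a =
      a^* * (ent X i i * a + ent X i j * b) + b^* * (ent X j i * a + ent X j j * b)
      - (a^* * a * ent X i i + b^* * b * ent X j j) by ring.
  apply: realB; first exact/ger0_real/quad.
  by apply: realD; apply: realM => //; rewrite mulrC ger0_real // mul_conjC_ge0.
have /CrealP := cross 1 1; rewrite conjC1 !mulr1 !mul1r rmorphD => e1.
have /CrealP := cross 1 'i; rewrite conjC1 conjCi !mulr1 !mul1r !rmorphD !rmorphM.
rewrite /= rmorphN /= conjCi opprK => e2.
have {}e2 : (ent X j i)^* - (ent X i j)^* = ent X i j - ent X j i.
  apply: (mulfI (neq0Ci C)); rewrite mulrBr [RHS]mulrBr.
  by transitivity (ent X i j * 'i + - 'i * ent X j i); [rewrite -e2|]; ring.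
apply: (can_inj conjCK); rewrite conjCK.
apply: (mulfI (_ : 2 != 0 :> C)); first by rewrite pnatr_eq0.
transitivity (ent X i j + ent X j i + (ent X i j - ent X j i)); last by ring.
by rewrite -e1 -e2; ring.
Qed.

End Entries.

(** * Kraus operators *)

Section Kraus.
Variable R : realType.
Local Notation C := (Cplx R).

Lemma psd_gram (I : finType) (X : op R I) : psd X ->
  exists Y : I -> I -> C, forall i j, ent X i j = \sum_t Y i t * (Y j t)^*.
Proof.
move=> Xpsd; have [] := @psdmx_factor _ _ X.
- by apply: op_ext => i j; rewrite ent_adj -psd_conj.
- exact: Xpsd.
- move=> Y XY; exists (fun i t => Y (enum_rank i) (enum_rank t)) => i j.
  rewrite /ent XY mxE sum_enum_rank; apply: eq_bigr => t _.
  by rewrite !mxE.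
Qed.

(** The Kraus representation, the sum over [t] of [W_t X W_t^t*], stated on entries so that product
    systems need only functions of labels. *)
Definition kraus_form (T I J : finType) (W : T -> J -> I -> C)
    (Phi : op R I -> op R J) :=
  forall X j j', ent (Phi X) j j' =
    \sum_t \sum_i \sum_i' W t j i * ent X i i' * (W t j' i')^*.

Definition kraus_map (T I J : finType) (W : T -> J -> I -> C) (X : op R I) : op R J :=
  mkop (fun j j' => \sum_t \sum_i \sum_i' W t j i * ent X i i' * (W t j' i')^*).

Lemma kraus_mapP (T I J : finType) (W : T -> J -> I -> C) :
  kraus_form W (kraus_map W).
Proof. by move=> X j j'; rewrite ent_mkop. Qed.

Lemma kraus_linear (T I J : finType) (W : T -> J -> I -> C) Phi :
  kraus_form W Phi -> linear Phi.
Proof.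
move=> PhiW a X Y; apply: op_ext => j j'.
rewrite entD entZ !PhiW mulr_sumr -big_split; apply: eq_bigr => t _.
rewrite mulr_sumr -big_split; apply: eq_bigr => i _.
rewrite mulr_sumr -big_split; apply: eq_bigr => i' _.
by rewrite /= entD entZ; ring.
Qed.

Lemma kraus_psd (T I J : finType) (W : T -> J -> I -> C) Phi X :
  kraus_form W Phi -> psd X -> psd (Phi X).
Proof.
move=> PhiW /psd_gram[Y XY].
apply: (@gram_psd _ _ (T * I)%type (fun j ts => \sum_i W ts.1 j i * Y i ts.2)).
move=> j j'; rewrite PhiW sum_pair; apply: eq_bigr => t _.
under eq_bigr do under eq_bigr do rewrite XY mulr_sumr mulr_suml.
under [RHS]eq_bigr do rewrite rmorph_sum mulr_sumlr.
rewrite [RHS]exchange_big; apply: eq_bigr => i _.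
rewrite [RHS]exchange_big; apply: eq_bigr => i' _.
by apply: eq_bigr => s _; rewrite rmorphM /=; ring.
Qed.

Lemma ent_ampl (I J K : finType) (Phi : op R I -> op R J)
    (X : op R (I * K)%type) j k j' k' :
  ent (ampl Phi X) (j, k) (j', k') =
  ent (Phi (mkop (fun i i' => ent X (i, k) (i', k')))) j j'.
Proof. by rewrite ent_mkop. Qed.

Lemma sum_pair_deltar (I K : finType) (F : I * K -> C) k :
  \sum_p F p * (p.2 == k)%:R = \sum_i F (i, k).
Proof. by rewrite sum_pair; apply: eq_bigr => i _; rewrite sum_deltar. Qed.

Lemma kraus_ampl (T I J K : finType) (W : T -> J -> I -> C) Phi :
  kraus_form W Phi ->
  kraus_form (fun t (p : J * K) (q : I * K) => W t p.1 q.1 * (q.2 == p.2)%:R)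
    (ampl Phi).
Proof.
move=> PhiW X [j k] [j' k']; rewrite ent_ampl PhiW; apply: eq_bigr => t _.
under [RHS]eq_bigr => p _.
  under eq_bigr => q _ do rewrite /= rmorphM /= conjC_nat mulrA.
  rewrite sum_pair_deltar /=.
  under eq_bigr => i' _ do rewrite -2!mulrA mulrCA (mulrC _%:R).
  rewrite -mulr_suml; over.
rewrite sum_pair_deltar; apply: eq_bigr => i _; apply: eq_bigr => i' _.
by rewrite ent_mkop; ring.
Qed.

Lemma kraus_CP (T I J : finType) (W : T -> J -> I -> C) Phi :
  kraus_form W Phi -> CP Phi.
Proof.
move=> PhiW; split; first exact: kraus_linear PhiW.
by move=> K X; apply: kraus_psd; exact: kraus_ampl PhiW.
Qed.

Lemma kraus_tr (T I J : finType) (W : T -> J -> I -> C) Phi :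
  kraus_form W Phi ->
  (forall i i', \sum_t \sum_j W t j i * (W t j i')^* = (i == i')%:R) ->
  forall X, \tr (Phi X) = \tr X.
Proof.
move=> PhiW W1 X; rewrite !mxtrace_ent.
transitivity (\sum_i \sum_i' ent X i i' * (i' == i)%:R); last first.
  by apply: eq_bigr => i _; rewrite sum_deltar.
under eq_bigr do rewrite PhiW.
rewrite exchange_big /=.
under eq_bigr => t _.
  rewrite exchange_big; under eq_bigr do rewrite exchange_big; over.
rewrite exchange_big; apply: eq_bigr => i _.
rewrite exchange_big; apply: eq_bigr => i' _.
rewrite eq_sym -W1 mulr_sumr; apply: eq_bigr => t _.
by rewrite mulr_sumr; apply: eq_bigr => j _; ring.
Qed.

Lemma kraus_CPTP (T I J : finType) (W : T -> J -> I -> C) Phi :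
  kraus_form W Phi ->
  (forall i i', \sum_t \sum_j W t j i * (W t j i')^* = (i == i')%:R) -> CPTP Phi.
Proof. by move=> PhiW W1; split; [exact: kraus_CP PhiW|exact: kraus_tr W1]. Qed.

Lemma linear_fun_sum (I J : finType) (Phi : op R I -> op R J) (S : finType)
    (a : S -> C) (X : S -> op R I) : linear Phi ->
  Phi (\sum_s a s *: X s) = \sum_s a s *: Phi (X s).
Proof.
move=> lin; have Phi0 : Phi 0 = 0.
  by have := lin (-1) 0 0; rewrite scaler0 add0r scaleN1r addNr.
apply: (big_rec2 (fun x y => Phi y = x)) => // s x y _ <-; exact: lin.
Qed.

Lemma linear_fun_ent (I J : finType) (Phi : op R I -> op R J) X j j' : linear Phi ->
  ent (Phi X) j j' = \sum_i \sum_i' ent X i i' * ent (Phi (ketbra R i i')) j j'.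
Proof.
move=> lin; rewrite {1}[X]op_sum_ketbra pair_bigA linear_fun_sum // ent_sum.
by rewrite [RHS]pair_bigA; apply: eq_bigr => p _; rewrite entZ.
Qed.

(* Choi's theorem, with Kraus operators read off a Gram factorization of the
   Choi matrix. *)
Lemma CP_kraus (I J : finType) (Phi : op R I -> op R J) : CP Phi ->
  exists W : J * I -> J -> I -> C, kraus_form W Phi.
Proof.
move=> [lin cp].
(* The unnormalized maximally entangled state: its blocks are the [ketbra R i i'], so
   [ampl Phi Omega] is the Choi matrix. *)
pose Omega : op R (I * I)%type :=
  mkop (fun p q => (p.1 == p.2)%:R * (q.1 == q.2)%:R).
have /cp/psd_gram[Y YE] : psd Omega.
  apply: (@gram_psd _ _ unit (fun p _ => (p.1 == p.2)%:R)) => p q.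
  by rewrite ent_mkop big_const card_unit /= addr0 conjC_nat.
exists (fun t j i => Y (j, i) t) => X j j'; rewrite linear_fun_ent //.
rewrite [RHS]exchange_big; apply: eq_bigr => i _.
rewrite [RHS]exchange_big; apply: eq_bigr => i' _.
under [RHS]eq_bigr do rewrite mulrAC.
rewrite -mulr_suml -YE ent_ampl mulrC; congr (ent (Phi _) _ _ * _).
by apply: op_ext => k k'; rewrite ent_mkop ent_mkop ent_ketbra.
Qed.

End Kraus.

(** * Channels on the reference system *)

Section Channels.
Variable R : realType.
Local Notation C := (Cplx R).

(** For bijective [h] this is conjugation by a permutation of the basis; it serves both to reorder
    tensor factors and to permute copies. *)
Definition relabel (I J : finType) (h : J -> I) (X : op R I) : op R J :=
  mkop (fun j j' => ent X (h j) (h j')).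

Lemma relabel_kraus (I J : finType) (h : J -> I) :
  kraus_form (fun (_ : unit) j i => (i == h j)%:R) (@relabel I J h).
Proof.
move=> X j j'; rewrite big_const card_unit /= addr0 ent_mkop.
under eq_bigr do under eq_bigr do rewrite conjC_nat.
under eq_bigr do rewrite sum_deltar.
by rewrite sum_deltal.
Qed.

Lemma relabel_CPTP (I J : finType) (h : J -> I) :
  bijective h -> CPTP (@relabel I J h).
Proof.
move=> hbij; apply: (kraus_CPTP (relabel_kraus h)) => i i'.
rewrite big_const card_unit /= addr0.
under eq_bigr do rewrite conjC_nat.
transitivity (\sum_k (k == i)%:R * (i' == k)%:R : C).
  rewrite [RHS](reindex h) /=; last exact: onW_bij.
  by apply: eq_bigr => k _; rewrite eq_sym.
by rewrite sum_deltal eq_sym.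
Qed.

Definition discard1 (S I : finType) (X : op R (S * I)%type) : op R I :=
  mkop (fun i i' => \sum_s ent X (s, i) (s, i')).

Lemma discard1_CPTP (S I : finType) : CPTP (@discard1 S I).
Proof.
pose W s i (p : S * I) : C := (p.1 == s)%:R * (p.2 == i)%:R.
have dW : kraus_form W (@discard1 S I).
  move=> X i i'; rewrite ent_mkop; apply: eq_bigr => s _.
  under eq_bigr do under eq_bigr do rewrite rmorphM /= !conjC_nat mulrA.
  under eq_bigr do rewrite sum_pair_deltar sum_deltar mulrAC.
  by rewrite sum_pair_deltar sum_deltal.
apply: (kraus_CPTP dW) => -[s i] [s' i'].
under eq_bigr => t _.
  under eq_bigr => j _ do
    rewrite /W /= rmorphM /= !conjC_nat mulrACA (eq_sym i).
  rewrite -mulr_sumr sum_deltal (eq_sym s); over.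
by rewrite -mulr_suml sum_deltal -natrM mulnb xpair_eqE (eq_sym s) (eq_sym i).
Qed.

(** A map on the reference with Kraus operators [W], tensored with the identity. The untouched
    factor [B] is the input system before [Phi] acts and its output system afterwards. *)
Definition id_tens (T K L B : finType) (W : T -> L -> K -> C) :=
  kraus_map (fun t (q : B * L) (p : B * K) => (p.1 == q.1)%:R * W t q.2 p.2).

Lemma ent_id_tens (T K L B : finType) (W : T -> L -> K -> C)
    (X : op R (B * K)%type) b l b' l' :
  ent (id_tens W X) (b, l) (b', l') =
  \sum_t \sum_k \sum_k' W t l k * ent X (b, k) (b', k') * (W t l' k')^*.
Proof.
rewrite ent_mkop; apply: eq_bigr => t _.
rewrite sum_pair (bigD1 b) //= [X in _ + X]big1 ?addr0; last first.
  move=> b1 /negPf b1b; rewrite big1 // => k _; rewrite big1 // => p _.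
  by rewrite /= b1b !mul0r.
apply: eq_bigr => k _.
rewrite sum_pair (bigD1 b') //= [X in _ + X]big1 ?addr0; last first.
  move=> b1 /negPf b1b; rewrite big1 // => k' _.
  by rewrite b1b mul0r rmorph0 mulr0.
by apply: eq_bigr => k' _; rewrite /= !eqxx !mul1r.
Qed.

Lemma id_tens_CPTP (T K L B : finType) (W : T -> L -> K -> C) :
  (forall k k', \sum_t \sum_l W t l k * (W t l k')^* = (k == k')%:R) ->
  CPTP (@id_tens T K L B W).
Proof.
move=> W1; apply: (kraus_CPTP (kraus_mapP _)) => -[b k] [b' k'] /=.
transitivity ((b == b')%:R * \sum_t \sum_l W t l k * (W t l k')^*); last first.
  by rewrite W1 -natrM mulnb.
rewrite mulr_sumr; apply: eq_bigr => t _; rewrite sum_pair exchange_big mulr_sumr.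
apply: eq_bigr => l _ /=.
under eq_bigr do rewrite rmorphM /= conjC_nat mulrACA (eq_sym b) (eq_sym b').
by rewrite -mulr_suml sum_deltal.
Qed.

Lemma gram_factor_fun (A I S : finType) (V : A -> I -> C) (W : A -> S -> C) :
  (forall a a', \sum_i V a i * (V a' i)^* = \sum_s W a s * (W a' s)^*) ->
  exists (U : I -> S -> C) (P : I -> I -> C),
    [/\ forall a s, W a s = \sum_i V a i * U i s,
        forall a j, \sum_i V a i * P i j = 0
      & forall i j, \sum_s U i s * (U j s)^* + \sum_s P i s * (P j s)^* =
                    (i == j)%:R].
Proof.
pose mx (X Y : finType) (f : X -> Y -> C) : 'M[C]_(#|{: X}|, #|{: Y}|) :=
  \matrix_(i, j) f (enum_val i) (enum_val j).
move=> VW; have /gram_factor_unique[U [P [WU VP UP]]] :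
    mx _ _ V *m (mx _ _ V)^t* = mx _ _ W *m (mx _ _ W)^t*.
  apply/matrixP => a a'; rewrite !mxE !sum_enum_rank.
  transitivity (\sum_i V (enum_val a) i * (V (enum_val a') i)^*).
    by apply: eq_bigr => i _; rewrite !mxE !enum_rankK.
  apply: etrans (VW _ _) _.
  by apply: eq_bigr => s _; rewrite !mxE !enum_rankK.
exists (fun i s => U (enum_rank i) (enum_rank s)).
exists (fun i j => P (enum_rank i) (enum_rank j)); split.
- move=> a s; have /matrixP/(_ (enum_rank a) (enum_rank s)) := WU.
  rewrite !mxE !enum_rankK => ->; rewrite sum_enum_rank.
  by apply: eq_bigr => i _; rewrite mxE !enum_rankK.
- move=> a j; have /matrixP/(_ (enum_rank a) (enum_rank j)) := VP.
  rewrite !mxE => VPaj; rewrite -[RHS]VPaj sum_enum_rank.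
  by apply: eq_bigr => i _; rewrite mxE !enum_rankK.
- move=> i j; have /matrixP/(_ (enum_rank i) (enum_rank j)) := UP.
  rewrite !mxE !sum_enum_rank (can_eq (@enum_rankK _)) => <-.
  by congr (_ + _); apply: eq_bigr => s _; rewrite !mxE.
Qed.

Lemma ent_projector (I : finType) (v : ket R I) i j :
  ent (projector v) i j = v (enum_rank i) 0 * (v (enum_rank j) 0)^*.
Proof. by rewrite /ent mxE big_ord1 !mxE. Qed.

Lemma projector_psd (I : finType) (v : ket R I) : psd (projector v).
Proof.
apply: (@gram_psd _ _ unit (fun i _ => v (enum_rank i) 0)) => i j.
by rewrite ent_projector big_const card_unit /= addr0.
Qed.

(* Every extension of the reduced state of a pure state [v] is obtained from
   [v] by a channel acting on the purifying system alone. *)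
Lemma steering (A I K : finType) (v : ket R (A * I)%type) (rho : op R (A * K)%type)
    (k0 : K) : psd rho -> ptrace2 (projector v) = ptrace2 rho ->
  exists (T : finType) (W : T -> K -> I -> C),
    (forall i i', \sum_t \sum_k W t k i * (W t k i')^* = (i == i')%:R) /\
    rho = id_tens W (projector v).
Proof.
move=> /psd_gram[Y rhoE] marg.
pose V a i := v (enum_rank (a, i)) 0.
(* Equality of the reduced states says that [V], and [Y] with the label of [K] moved to the column
   side, have the same Gram matrix. *)
have /gram_factor_fun[U [P [YU VP UP]]] :
    forall a a', \sum_i V a i * (V a' i)^* =
      \sum_(s : K * (A * K)) Y (a, s.1) s.2 * (Y (a', s.1) s.2)^*.
  move=> a a'; have /(congr1 (fun X => ent X a a')) := marg.
  rewrite !ent_mkop sum_pair => margaa'.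
  transitivity (\sum_j ent (projector v) (a, j) (a', j)).
    by apply: eq_bigr => i _; rewrite ent_projector.
  by rewrite margaa'; apply: eq_bigr => k _; rewrite rhoE.
exists ((A * K) + I)%type.
(* The [inl] operators reshape the partial isometry [U]. The [inr] operators restore trace
   preservation by sending its defect to [k0]; they vanish on [v] by [VP]. *)
exists (fun t k i => match t with inl s => U i (k, s)
                                | inr j => (k == k0)%:R * P i j end); split.
  move=> i i'; rewrite -UP sum_pair; rewrite big_sumType /=; congr (_ + _).
    by rewrite exchange_big.
  apply: eq_bigr => j _.
  under eq_bigr do rewrite rmorphM /= conjC_nat -mulrA.
  by rewrite sum_deltal eqxx mul1r.
apply: op_ext => -[a k] [a' k']; rewrite ent_id_tens big_sumType /=.
rewrite [X in _ + X]big1 ?addr0; last first.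
  move=> j _; transitivity (((k == k0)%:R * \sum_i V a i * P i j) *
    ((k' == k0)%:R * \sum_i V a' i * P i j)^*); last by rewrite VP !mulr0 mul0r.
  rewrite !mulr_sumr rmorph_sum /= mulr_sumlr; apply: eq_bigr => i _.
  apply: eq_bigr => i' _.
  by rewrite ent_projector !rmorphM /= conjC_nat /V; ring.
rewrite rhoE; apply: eq_bigr => s _; rewrite (YU a (k, s)) (YU a' (k', s)).
rewrite rmorph_sum /= mulr_sumlr; apply: eq_bigr => i _; apply: eq_bigr => i' _.
by rewrite ent_projector rmorphM /V /=; ring.
Qed.

End Channels.

(** * Outputs and mixtures *)

Section Outputs.
Variable R : realType.
Local Notation C := (Cplx R).

Lemma cplx_ge0 (a : R) : 0 <= a -> 0 <= (a%:C%C : C).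
Proof. by rewrite lecR. Qed.

Lemma psdD (I : finType) (X Y : op R I) : psd X -> psd Y -> psd (X + Y).
Proof.
move=> Xpsd Ypsd v; rewrite mulmxDr mulmxDl mxE.
by apply: addr_ge0; [exact: Xpsd|exact: Ypsd].
Qed.

Lemma psdZ (I : finType) (a : C) (X : op R I) : 0 <= a -> psd X -> psd (a *: X).
Proof.
move=> a0 Xpsd v; rewrite -scalemxAr -scalemxAl mxE.
by apply: mulr_ge0 => //; exact: Xpsd.
Qed.

Lemma psd0 (I : finType) : psd (0 : op R I).
Proof. by move=> v; rewrite mulmx0 mul0mx mxE. Qed.

Definition mixture (X I : finType) (p : X -> R) (rho : X -> op R I) : op R I :=
  \sum_x ((p x)%:C%C : C) *: rho x.

Lemma mixture_psd (X I : finType) (p : X -> R) (rho : X -> op R I) :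
  (forall x, 0 <= p x) -> (forall x, psd (rho x)) -> psd (mixture p rho).
Proof.
move=> p0 rho0; apply: (@big_ind _ (@psd R I)); first exact: psd0.
  exact: psdD.
by move=> x _; apply: psdZ => //; exact: cplx_ge0.
Qed.

Lemma mxtrace_mixture (X I : finType) (p : X -> R) (rho : X -> op R I) :
  \tr (mixture p rho) = \sum_x ((p x)%:C%C : C) * \tr (rho x).
Proof.
rewrite /mixture raddf_sum /=; apply: eq_bigr => x _.
by rewrite mxtraceZ.
Qed.

Lemma mixture_density (X I : finType) (p : X -> R) (rho : X -> op R I) :
  (forall x, 0 <= p x) -> \sum_x p x = 1 -> (forall x, density (rho x)) ->
  density (mixture p rho).
Proof.
move=> p0 p1 rhod; split.
  by apply: mixture_psd => // x; have [] := rhod x.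
rewrite mxtrace_mixture; under eq_bigr => x _.
  by have [_ ->] := rhod x; rewrite mulr1; over.
by rewrite -(rmorph_sum (real_complex R)) /= p1.
Qed.

Lemma ent_mixture (X I : finType) (p : X -> R) (rho : X -> op R I) i j :
  ent (mixture p rho) i j = \sum_x ((p x)%:C%C : C) * ent (rho x) i j.
Proof. by rewrite ent_sum; apply: eq_bigr => x _; rewrite entZ. Qed.

Lemma ent_output (A E B K : finType) (Phi : op R (A * E)%type -> op R B)
    (rho : op R (A * K)%type) (sigma : op R E) b k b' k' : linear Phi ->
  ent (output Phi rho sigma) (b, k) (b', k') =
  \sum_p \sum_q ent rho (p.1, k) (q.1, k') * ent sigma p.2 q.2 *
                ent (Phi (ketbra R p q)) b b'.
Proof.
move=> lin; rewrite ent_ampl linear_fun_ent //.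
by do 2!apply: eq_bigr => ? _; rewrite !ent_mkop.
Qed.

Lemma joint_input_psd (A E K : finType) (rho : op R (A * K)%type) (sigma : op R E) :
  psd rho -> psd sigma -> psd (joint_input rho sigma).
Proof.
move=> /psd_gram[Y rhoE] /psd_gram[Z sigmaE].
apply: (@gram_psd _ _ _ (fun p t => Y (p.1.1, p.2) t.1 * Z p.1.2 t.2)) => p q.
rewrite ent_mkop rhoE sigmaE mulr_sumlr pair_bigA; apply: eq_bigr => t _.
by rewrite rmorphM /=; ring.
Qed.

Lemma output_psd (A E B K : finType) (Phi : op R (A * E)%type -> op R B)
    (rho : op R (A * K)%type) (sigma : op R E) :
  CP Phi -> psd rho -> psd sigma -> psd (output Phi rho sigma).
Proof. by move=> [_ cp] rho0 sigma0; apply: cp; exact: joint_input_psd. Qed.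

Lemma mxtrace_output (A E B K : finType) (Phi : op R (A * E)%type -> op R B)
    (rho : op R (A * K)%type) (sigma : op R E) :
  (forall X, \tr (Phi X) = \tr X) -> \tr (output Phi rho sigma) = \tr rho * \tr sigma.
Proof.
move=> tp; rewrite !mxtrace_ent sum_pair exchange_big /=.
under eq_bigr => k _.
  under eq_bigr do rewrite ent_ampl.
  rewrite -mxtrace_ent tp mxtrace_ent sum_pair.
  under eq_bigr do under eq_bigr do rewrite !ent_mkop /=.
  under eq_bigr do rewrite -mulr_sumr.
  rewrite -mulr_suml; over.
by rewrite -mulr_suml; congr (_ * _); rewrite [RHS]sum_pair exchange_big.
Qed.

Lemma output_density (A E B K : finType) (Phi : op R (A * E)%type -> op R B)
    (rho : op R (A * K)%type) (sigma : op R E) :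
  CPTP Phi -> density rho -> density sigma -> density (output Phi rho sigma).
Proof.
move=> [cp tp] [rho0 rho1] [sigma0 sigma1]; split; first exact: output_psd.
by rewrite mxtrace_output // rho1 sigma1 mulr1.
Qed.

Lemma output_id_tens (T A E B K L : finType) (W : T -> L -> K -> C)
    (Phi : op R (A * E)%type -> op R B) (rho : op R (A * K)%type) (sigma : op R E) :
  linear Phi ->
  output Phi (id_tens W rho) sigma = id_tens W (output Phi rho sigma).
Proof.
move=> lin; apply: op_ext => -[b l] [b' l']; rewrite ent_output // ent_id_tens.
under eq_bigr => p _.
  under eq_bigr => q _.
    rewrite ent_id_tens; under eq_bigr do rewrite pair_bigA.
    rewrite pair_bigA -mulrA mulr_suml; over.
  over.
under [RHS]eq_bigr do rewrite pair_bigA; rewrite [RHS]pair_bigA.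
under eq_bigr do rewrite exchange_big; rewrite exchange_big /=.
apply: eq_bigr => -[t [k k']] _ /=; rewrite ent_output // mulr_sumr mulr_suml.
apply: eq_bigr => p _; rewrite mulr_sumr mulr_suml; apply: eq_bigr => q _.
by ring.
Qed.

Lemma output_mixturel (X A E B K : finType) (Phi : op R (A * E)%type -> op R B)
    (p : X -> R) (rho : X -> op R (A * K)%type) (sigma : op R E) : linear Phi ->
  output Phi (mixture p rho) sigma = mixture p (fun x => output Phi (rho x) sigma).
Proof.
move=> lin; apply: op_ext => -[b k] [b' k']; rewrite ent_output // ent_mixture.
under [RHS]eq_bigr do rewrite ent_output // mulr_sumr.
rewrite [RHS]exchange_big; apply: eq_bigr => u _.
under [RHS]eq_bigr do rewrite mulr_sumr.
rewrite [RHS]exchange_big; apply: eq_bigr => v _.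
by rewrite ent_mixture -mulrA mulr_suml; apply: eq_bigr => x _; ring.
Qed.

Lemma output_mixturer (X A E B K : finType) (Phi : op R (A * E)%type -> op R B)
    (p : X -> R) (rho : op R (A * K)%type) (sigma : X -> op R E) : linear Phi ->
  output Phi rho (mixture p sigma) = mixture p (fun x => output Phi rho (sigma x)).
Proof.
move=> lin; apply: op_ext => -[b k] [b' k']; rewrite ent_output // ent_mixture.
under [RHS]eq_bigr do rewrite ent_output // mulr_sumr.
rewrite [RHS]exchange_big; apply: eq_bigr => u _.
under [RHS]eq_bigr do rewrite mulr_sumr.
rewrite [RHS]exchange_big; apply: eq_bigr => v _.
by rewrite ent_mixture mulrAC mulr_sumr; apply: eq_bigr => x _; ring.
Qed.

Lemma output_relabel (A E B K : finType) (Phi : op R (A * E)%type -> op R B)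
    (hA : A -> A) (hE : E -> E) (hB : B -> B)
    (rho : op R (A * K)%type) (sigma : op R E) :
  (forall X, Phi (relabel (fun p => (hA p.1, hE p.2)) X) = relabel hB (Phi X)) ->
  output Phi (relabel (fun p => (hA p.1, p.2)) rho) (relabel hE sigma) =
  relabel (fun p => (hB p.1, p.2)) (output Phi rho sigma).
Proof.
move=> cov; apply: op_ext => -[b k] [b' k'].
rewrite [RHS]ent_mkop !ent_ampl /=.
have := cov (mkop (fun i i' => ent (joint_input rho sigma) (i, k) (i', k'))).
move=> /(congr1 (fun Z => ent Z b b')); rewrite [in RHS]ent_mkop => <-.
by congr (ent (Phi _) _ _); apply: op_ext => p q; rewrite !ent_mkop.
Qed.

Lemma ptrace2_psd (A K : finType) (rho : op R (A * K)%type) :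
  psd rho -> psd (ptrace2 rho).
Proof.
move=> /psd_gram[Y rhoE].
apply: (@gram_psd _ _ _ (fun a (u : K * (A * K)) => Y (a, u.1) u.2)) => a a'.
by rewrite ent_mkop sum_pair; apply: eq_bigr => k _; rewrite rhoE.
Qed.

Lemma mxtrace_ptrace2 (A K : finType) (rho : op R (A * K)%type) :
  \tr (ptrace2 rho) = \tr rho.
Proof.
by rewrite !mxtrace_ent sum_pair; apply: eq_bigr => a _; rewrite ent_mkop.
Qed.

Lemma ptrace2_density (A K : finType) (rho : op R (A * K)%type) :
  density rho -> density (ptrace2 rho).
Proof. by move=> [rho0 rho1]; split; [exact: ptrace2_psd|rewrite mxtrace_ptrace2]. Qed.

Lemma ptrace2_mixture (X A K : finType) (p : X -> R) (rho : X -> op R (A * K)%type) :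
  ptrace2 (mixture p rho) = mixture p (fun x => ptrace2 (rho x)).
Proof.
apply: op_ext => a a'; rewrite ent_mkop ent_mixture.
under eq_bigr do rewrite ent_mixture.
by rewrite exchange_big; apply: eq_bigr => x _; rewrite ent_mkop mulr_sumr.
Qed.

Lemma ptrace2_id_tens (T A K L : finType) (W : T -> L -> K -> C)
    (rho : op R (A * K)%type) :
  (forall k k', \sum_t \sum_l W t l k * (W t l k')^* = (k == k')%:R) ->
  ptrace2 (id_tens W rho) = ptrace2 rho.
Proof.
move=> W1; apply: op_ext => a a'; rewrite !ent_mkop.
transitivity (\sum_k \sum_k' ent rho (a, k) (a', k') * (k' == k)%:R); last first.
  by apply: eq_bigr => k _; rewrite sum_deltar.
under eq_bigr do rewrite ent_id_tens.
rewrite exchange_big /=.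
under eq_bigr => t _.
  rewrite exchange_big; under eq_bigr do rewrite exchange_big; over.
rewrite exchange_big; apply: eq_bigr => k _.
rewrite exchange_big; apply: eq_bigr => k' _.
rewrite eq_sym -W1 mulr_sumr; apply: eq_bigr => t _.
by rewrite mulr_sumr; apply: eq_bigr => l _; ring.
Qed.

Lemma ptrace2_relabel (A K : finType) (h : A -> A) (rho : op R (A * K)%type) :
  ptrace2 (relabel (fun p => (h p.1, p.2)) rho) = relabel h (ptrace2 rho).
Proof.
by apply: op_ext => a a'; rewrite !ent_mkop; apply: eq_bigr => k _; rewrite ent_mkop.
Qed.

(** The isometry appending the flag [x] to the reference register; it is a single Kraus operator,
    hence the index [unit]. *)
Definition flag_kraus (X K : finType) (x : X) : unit -> X * K -> K -> C :=
  fun _ q k => (q.1 == x)%:R * (q.2 == k)%:R.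

Lemma ent_flag (X B K : finType) (x : X) (Y : op R (B * K)%type) b y k b' y' k' :
  ent (id_tens (@flag_kraus X K x) Y) (b, (y, k)) (b', (y', k')) =
  (y == x)%:R * (y' == x)%:R * ent Y (b, k) (b', k').
Proof.
rewrite ent_id_tens (big_pred1 tt) /flag_kraus /=; last by case.
under eq_bigr do under eq_bigr do rewrite rmorphM /= !conjC_nat /= mulrA (eq_sym k').
under eq_bigr do rewrite sum_deltar (eq_sym k) -!mulrA mulrCA.
by rewrite sum_deltal; ring.
Qed.

Lemma flag_complete (X K : finType) (x : X) (k k' : K) :
  \sum_(t : unit) \sum_l flag_kraus x t l k * (flag_kraus x t l k')^* =
  (k == k')%:R.
Proof.
rewrite (big_pred1 tt) ?sum_pair /flag_kraus /=; last by case.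
under eq_bigr => y _.
  under eq_bigr do rewrite rmorphM /= !conjC_nat mulrACA.
  rewrite -mulr_sumr sum_deltal -mulrA; over.
by rewrite sum_deltal eqxx mul1r.
Qed.

(** The flag is created inside the reference, whereas the direct-sum property expects it in
    front. *)
Lemma relabel_flag_mixture (X B K : finType) (p : X -> R)
    (Y : X -> op R (B * K)%type) :
  relabel (fun u : X * (B * K) => (u.2.1, (u.1, u.2.2)))
    (mixture p (fun x => id_tens (@flag_kraus X K x) (Y x))) =
  classical_quantum p Y.
Proof.
apply: op_ext => -[x [b k]] [x' [b' k']]; rewrite ent_mkop ent_mixture ent_sum /=.
apply: eq_bigr => y _; rewrite entZ ent_flag ent_mkop ent_ketbra /=.
by ring.
Qed.

Lemma discard1_cq (X I : finType) (p : X -> R) (rho : X -> op R I) :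
  discard1 (classical_quantum p rho) = mixture p rho.
Proof.
apply: op_ext => i i'; rewrite ent_mkop ent_mixture; apply: eq_bigr => x _.
rewrite ent_sum; under eq_bigr do rewrite entZ ent_mkop ent_ketbra /= mulrCA.
under eq_bigr do rewrite -mulrA (eq_sym x).
by rewrite sum_deltal eqxx mul1r.
Qed.

Lemma classical_quantum_psd (X I : finType) (p : X -> R) (rho : X -> op R I) :
  (forall x, 0 <= p x) -> (forall x, psd (rho x)) -> psd (classical_quantum p rho).
Proof.
move=> p0 rho0; apply: mixture_psd => // x; have /psd_gram[Y YE] := rho0 x.
apply: (@gram_psd _ _ _ (fun u t => (u.1 == x)%:R * Y u.2 t)) => u u'.
rewrite ent_mkop ent_ketbra YE mulr_sumr; apply: eq_bigr => t _.
by rewrite rmorphM /= conjC_nat; ring.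
Qed.

Lemma classical_quantum_density (X I : finType) (p : X -> R) (rho : X -> op R I) :
  (forall x, 0 <= p x) -> \sum_x p x = 1 -> (forall x, density (rho x)) ->
  density (classical_quantum p rho).
Proof.
move=> p0 p1 rhod; split.
  by apply: classical_quantum_psd => // x; have [] := rhod x.
have [_ tp] := @discard1_CPTP R X I.
by rewrite -tp discard1_cq; have [] := mixture_density p0 p1 rhod.
Qed.

End Outputs.

(** * Tensor powers and permutations *)

Section TensorPower.
Variable R : realType.
Local Notation C := (Cplx R).

Lemma ent_kraus_ketbra (T I J : finType) (W : T -> J -> I -> C) Phi i i' j j' :
  kraus_form W Phi ->
  ent (Phi (ketbra R i i')) j j' = \sum_t W t j i * (W t j' i')^*.
Proof.
move=> ->; apply: eq_bigr => t _.
under eq_bigr do under eq_bigr do rewrite ent_ketbra mulrA mulrAC.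
by under eq_bigr do rewrite sum_deltar mulrAC; rewrite sum_deltar.
Qed.

(** Distributing the product over the sums gives product Kraus operators; the positivity of
    [tensor_pow] comes from here. *)
Lemma tensor_pow_kraus (n : nat) (T A E B : finType) (W : T -> B -> A * E -> C)
    (Phi : op R (A * E)%type -> op R B) :
  kraus_form W Phi ->
  kraus_form
    (fun (t : copies n T) (b : copies n B) (p : copies n A * copies n E) =>
       \prod_(k < n) W (t k) (b k) (p.1 k, p.2 k))
    (@tensor_pow R n A E B Phi).
Proof.
move=> PhiW X b b'; rewrite ent_mkop.
rewrite [RHS]exchange_big; apply: eq_bigr => p _.
rewrite [RHS]exchange_big; apply: eq_bigr => q _.
rewrite (eq_bigr _ (fun k _ => ent_kraus_ketbra _ _ _ _ PhiW)).
rewrite bigA_distr_bigA mulr_sumr; apply: eq_bigr => t _.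
by rewrite big_split rmorph_prod /= mulrCA mulrA.
Qed.

Lemma tensor_pow_CP (n : nat) (A E B : finType) (Phi : op R (A * E)%type -> op R B) :
  CP Phi -> CP (@tensor_pow R n A E B Phi).
Proof. by move=> /CP_kraus[W PhiW]; exact: kraus_CP (tensor_pow_kraus PhiW). Qed.

Lemma tensor_pow_CPTP (n : nat) (A E B : finType) (Phi : op R (A * E)%type -> op R B) :
  CPTP Phi -> CPTP (@tensor_pow R n A E B Phi).
Proof.
move=> [cp tp]; split; first exact: tensor_pow_CP.
move=> X; rewrite !mxtrace_ent.
under eq_bigr do rewrite ent_mkop.
transitivity (\sum_p \sum_q ent X p q * (q == p)%:R); last first.
  by apply: eq_bigr => p _; rewrite sum_deltar.
rewrite exchange_big; apply: eq_bigr => p _.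
rewrite exchange_big; apply: eq_bigr => q _.
rewrite -mulr_sumr; congr (_ * _).
(* The trace of a product operator is a product of traces, and trace preservation turns each factor
   into a Kronecker symbol. *)
rewrite -(bigA_distr_bigA (fun k j =>
  ent (Phi (ketbra R (p.1 k, p.2 k) (q.1 k, q.2 k))) j j)) /=.
under eq_bigr => k _.
  rewrite -mxtrace_ent tp mxtrace_ent.
  under eq_bigr do rewrite ent_ketbra.
  rewrite sum_deltal; over.
case: eqP => [->|qp]; first by rewrite big1 // => k _; rewrite eqxx.
apply/eqP; rewrite prodf_seq_eq0; apply/hasP.
have [k pqk] : exists k, (p.1 k, p.2 k) != (q.1 k, q.2 k).
  apply/not_existsP => pq; apply: qp; case: p q pq => [a e] [a' e'] /= pq.
  by congr pair; apply/ffunP => k; have /negP/negPn/eqP[] := pq k.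
by exists k; rewrite ?mem_index_enum //= (negPf pqk).
Qed.

(** * Permutations of tensor factors *)

Definition permf (n : nat) (I : finType) (s : 'S_n) (x : copies n I) : copies n I :=
  [ffun k => x (s k)].

(** The order is kept because [(s * t) k = t (s k)] for permutations. *)
Lemma permfM (n : nat) (I : finType) (s t : 'S_n) (x : copies n I) :
  permf s (permf t x) = permf (s * t) x.
Proof. by apply/ffunP => k; rewrite !ffunE permM. Qed.

Lemma permf1 (n : nat) (I : finType) (x : copies n I) : permf 1%g x = x.
Proof. by apply/ffunP => k; rewrite ffunE perm1. Qed.

Lemma permfK (n : nat) (I : finType) (s : 'S_n) :
  cancel (@permf n I s) (permf s^-1).
Proof. by move=> x; rewrite permfM mulVg permf1. Qed.

Lemma permfKV (n : nat) (I : finType) (s : 'S_n) :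
  cancel (@permf n I s^-1) (permf s).
Proof. by move=> x; rewrite permfM mulgV permf1. Qed.

Lemma permf_bij (n : nat) (I : finType) (s : 'S_n) : bijective (@permf n I s).
Proof. exact: Bijective (@permfK n I s) (@permfKV n I s). Qed.

Lemma tensor_pow_perm (n : nat) (A E B : finType) (Phi : op R (A * E)%type -> op R B)
    (s : 'S_n) X :
  tensor_pow Phi (relabel (fun p => (permf s p.1, permf s p.2)) X) =
  relabel (permf s) (@tensor_pow R n A E B Phi X).
Proof.
apply: op_ext => b b'; rewrite !ent_mkop.
pose h (p : copies n A * copies n E) := (permf s p.1, permf s p.2).
have hbij : bijective h.
  exists (fun p => (permf s^-1 p.1, permf s^-1 p.2)) => -[a e].
    by rewrite /h /= !permfK.
  by rewrite /h /= !permfKV.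
rewrite [RHS](reindex h) /=; last exact: onW_bij.
apply: eq_bigr => p _; rewrite [RHS](reindex h) /=; last exact: onW_bij.
apply: eq_bigr => q _; rewrite ent_mkop; congr (_ * _).
rewrite (reindex_inj (@perm_inj _ s)); apply: eq_bigr => k _.
by rewrite !ffunE.
Qed.

(** The unitary sends the basis vector [x] to [permf s x], so the entry at [y] is read off at the
    preimage of [y]: hence the inverse. *)
Lemma perm_unitary_conj (n : nat) (I : finType) (s : 'S_n) (X : op R (copies n I)) :
  perm_unitary R I s *m X *m (perm_unitary R I s)^t* = relabel (permf s^-1) X.
Proof.
apply: op_ext => y y'; rewrite ent_mkop ent_mulmx.
have permE (z x : copies n I) : (z == permf s x) = (x == permf s^-1 z).
  by apply/eqP/eqP => ->; rewrite ?permfK ?permfKV.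
under eq_bigr => x _.
  rewrite ent_mulmx ent_adj ent_mkop conjC_nat permE.
  under eq_bigr do rewrite ent_mkop permE.
  rewrite sum_deltal; over.
by rewrite sum_deltar.
Qed.

Lemma relabel_density (I J : finType) (h : J -> I) (X : op R I) :
  bijective h -> density X -> density (relabel h X).
Proof.
move=> /(@relabel_CPTP R)[_ tp] [X0 X1]; split; last by rewrite tp.
exact: kraus_psd (relabel_kraus h) X0.
Qed.

Lemma PERMP (n : nat) (I : finType) (X : op R (copies n I)) :
  PERM X <-> density X /\ forall s : 'S_n, relabel (permf s) X = X.
Proof.
split=> -[Xd Xinv]; split=> // s.
  by rewrite -{1}(invgK s) -perm_unitary_conj Xinv.
by rewrite perm_unitary_conj Xinv.
Qed.

Definition uniform_perm (n : nat) (_ : 'S_n) : R := (#|'S_n|%:R)^-1.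

Lemma uniform_perm_ge0 (n : nat) (s : 'S_n) : 0 <= uniform_perm s.
Proof. by rewrite invr_ge0. Qed.

Lemma uniform_perm_sum (n : nat) : \sum_(s : 'S_n) uniform_perm s = 1.
Proof.
rewrite /uniform_perm sumr_const -[LHS]mulr_natr mulVf // pnatr_eq0 -lt0n.
by apply/card_gt0P; exists 1%g.
Qed.

Definition symmetrize (n : nat) (I : finType) (X : op R (copies n I)) :
    op R (copies n I) :=
  mixture (@uniform_perm n) (fun s => relabel (permf s) X).

Lemma symmetrize_PERM (n : nat) (I : finType) (X : op R (copies n I)) :
  density X -> PERM (symmetrize X).
Proof.
move=> Xd; apply/PERMP; split.
  apply: mixture_density => [||s]; [exact: uniform_perm_ge0|exact: uniform_perm_sum|].
  by apply: relabel_density => //; exact: permf_bij.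
move=> s; apply: op_ext => x y; rewrite ent_mkop !ent_mixture.
(* Right translation by [s] absorbs the extra relabelling. *)
rewrite [RHS](reindex_inj (@mulIg _ s)); apply: eq_bigr => t _.
by rewrite !ent_mkop !permfM.
Qed.

End TensorPower.

(** * Concavity and convexity of the output divergence *)

Section ChannelDivergence.
Variables (R : realType) (D : functional R).
Hypotheses (D_div : quantum_divergence D) (D_sum : direct_sum_property D).
Local Open Scope ereal_scope.

Section OneChannelPair.
Variables (A E B : finType) (N M : op R (A * E)%type -> op R B).
Hypotheses (N_cptp : CPTP N) (M_cp : CP M).

Definition Dout (K : finType) (rho : op R (A * K)%type) (sigma omega : op R E) :=
  D (output N rho sigma) (output M rho omega).

Lemma Dout_ninfty (K : finType) (rho : op R (A * K)%type) sigma omega :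
  density rho -> density sigma -> density omega -> Dout rho sigma omega != -oo.
Proof.
move=> rhod sigmad omegad; have [Dninfty _] := D_div; apply: Dninfty.
  exact: output_density.
by apply: output_psd => //; [case: rhod|case: omegad].
Qed.

Lemma Dout_data_processing (K L B' : finType) (Psi : op R (B * K)%type -> op R B')
    (rho : op R (A * K)%type) sigma omega :
  CPTP Psi -> density rho -> density sigma -> density omega ->
  D (Psi (output N rho sigma)) (Psi (output M rho omega)) <= Dout rho sigma omega.
Proof.
move=> Psic rhod sigmad omegad; have [_ Dproc] := D_div; apply: Dproc => //.
  exact: output_density.
by apply: output_psd => //; [case: rhod|case: omegad].
Qed.

Lemma Dout_le_purification (I K : finType) (v : ket R (A * I)%type)
    (rho : op R (A * K)%type) sigma omega :
  density rho -> density sigma -> density omega ->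
  purifies v (ptrace2 rho) -> Dout rho sigma omega <= Dout (projector v) sigma omega.
Proof.
move=> rhod sigmad omegad vrho.
(* Unit trace forces [K] to be inhabited, which provides the label that [steering] asks for. *)
have [k0] : exists k : K, true.
  apply/not_existsP => K0; have [_] := rhod; rewrite mxtrace_ent big1.
    by move/esym/eqP; rewrite oner_eq0.
  by move=> [a k] _; case: (K0 k).
have [rho0 _] := rhod => _; have [T [W [W1 rhoE]]] := steering k0 rho0 vrho.
have vd : density (projector v).
  split; first exact: projector_psd.
  by rewrite -mxtrace_ptrace2 vrho mxtrace_ptrace2; case: rhod.
rewrite [in leLHS]rhoE /Dout !output_id_tens; [|by case: M_cp|by case: N_cptp => -[]].
by apply: Dout_data_processing => //; exact: id_tens_CPTP.
Qed.

(** An extension of the mixture of reduced states whose reference remembers [x]. *)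
Definition flag_state (X K : finType) (p : X -> R) (rho : X -> op R (A * K)%type) :=
  mixture p (fun x => id_tens (@flag_kraus R X K x) (rho x)).

Lemma flag_state_density (X K : finType) (p : X -> R)
    (rho : X -> op R (A * K)%type) :
  (forall x, 0 <= p x)%R -> (\sum_x p x = 1)%R -> (forall x, density (rho x)) ->
  density (flag_state p rho).
Proof.
move=> p0 p1 rhod; apply: mixture_density => // x.
have [[_ cp] tp] : CPTP (@id_tens R _ _ _ A (@flag_kraus R X K x)).
  by apply: id_tens_CPTP; exact: flag_complete.
have [rho0 rho1] := rhod x; split; last by rewrite tp.
by apply: kraus_psd rho0; exact: kraus_mapP.
Qed.

Lemma ptrace2_flag_state (X K : finType) (p : X -> R)
    (rho : X -> op R (A * K)%type) :
  ptrace2 (flag_state p rho) = mixture p (fun x => ptrace2 (rho x)).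
Proof.
rewrite ptrace2_mixture; congr mixture; apply/funext => x.
by apply: ptrace2_id_tens; exact: flag_complete.
Qed.

Lemma output_flag_state (X K : finType) (p : X -> R)
    (rho : X -> op R (A * K)%type) (Phi : op R (A * E)%type -> op R B) sigma :
  linear Phi ->
  relabel (fun u : X * (B * K) => (u.2.1, (u.1, u.2.2)))
    (output Phi (flag_state p rho) sigma) =
  classical_quantum p (fun x => output Phi (rho x) sigma).
Proof.
move=> lin; rewrite output_mixturel // -relabel_flag_mixture; congr relabel.
by congr mixture; apply/funext => x; rewrite output_id_tens.
Qed.

Lemma Dout_concave (X K : finType) (p : X -> R) (rho : X -> op R (A * K)%type)
    sigma omega :
  (forall x, 0 <= p x)%R -> (\sum_x p x = 1)%R -> (forall x, density (rho x)) ->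
  density sigma -> density omega ->
  \sum_x (p x)%:E * Dout (rho x) sigma omega <= Dout (flag_state p rho) sigma omega.
Proof.
move=> p0 p1 rhod sigmad omegad; rewrite -D_sum //; first last.
- by move=> x; apply: output_psd => //; [case: (rhod x)|case: omegad].
- by move=> x; exact: output_density.
(* Bringing the flag to the front is a channel, so data processing bounds the average by the flagged
   divergence. *)
rewrite -!output_flag_state; [|by case: M_cp|by case: N_cptp => -[]].
apply: Dout_data_processing => //; last exact: flag_state_density.
apply: relabel_CPTP.
by exists (fun u => (u.2.1, (u.1, u.2.2))) => -[? []].
Qed.

Lemma Dout_convex (X K : finType) (p : X -> R) (rho : op R (A * K)%type)
    (sigma omega : X -> op R E) :
  (forall x, 0 <= p x)%R -> (\sum_x p x = 1)%R -> density rho ->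
  (forall x, density (sigma x)) -> (forall x, density (omega x)) ->
  Dout rho (mixture p sigma) (mixture p omega) <=
  \sum_x (p x)%:E * Dout rho (sigma x) (omega x).
Proof.
move=> p0 p1 rhod sigmad omegad; rewrite /Dout !output_mixturer; first last.
- by case: N_cptp => -[].
- by case: M_cp.
have outd x : density (output N rho (sigma x)) by exact: output_density.
have outp x : psd (output M rho (omega x)).
  by apply: output_psd => //; [case: rhod|case: (omegad x)].
rewrite -D_sum // -!discard1_cq; have [_ Dproc] := D_div; apply: Dproc.
- exact: discard1_CPTP.
- exact: classical_quantum_density.
- exact: classical_quantum_psd.
Qed.

(** By covariance the relabelling of the inputs reappears on the output system, where it is a
    channel. *)
Lemma Dout_le_relabel (K : finType) (hA : A -> A) (hE : E -> E) (hB : B -> B)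
    (rho : op R (A * K)%type) sigma omega :
  (forall X, N (relabel (fun p => (hA p.1, hE p.2)) X) = relabel hB (N X)) ->
  (forall X, M (relabel (fun p => (hA p.1, hE p.2)) X) = relabel hB (M X)) ->
  bijective hB -> density rho -> density sigma -> density omega ->
  Dout (relabel (fun p => (hA p.1, p.2)) rho) (relabel hE sigma) (relabel hE omega)
    <= Dout rho sigma omega.
Proof.
move=> Nh Mh [hB' hBK hB'K] rhod sigmad omegad.
rewrite /Dout (output_relabel _ _ Nh) (output_relabel _ _ Mh).
apply: Dout_data_processing => //; apply: relabel_CPTP.
by exists (fun p => (hB' p.1, p.2)) => -[b k] /=; rewrite ?hBK ?hB'K.
Qed.

(** * Inputs given by a chosen purification *)

Section Purified.
Variable purif : op R A -> ket R (A * A)%type.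
Hypothesis purifP : forall rho, density rho -> purifies (purif rho) rho.

Definition Fout (rho : op R A) (sigma omega : op R E) :=
  Dout (projector (purif rho)) sigma omega.

Lemma purif_density rho : density rho -> density (projector (purif rho)).
Proof.
move=> rhod; split; first exact: projector_psd.
by rewrite -mxtrace_ptrace2 (purifP rhod); case: rhod.
Qed.

(** The chosen purification dominates every extension, other purifications included; this is what
    makes [Fout] a function of the state alone. *)
Lemma Dout_le_Fout (K : finType) (rho : op R (A * K)%type) sigma omega :
  density rho -> density sigma -> density omega ->
  Dout rho sigma omega <= Fout (ptrace2 rho) sigma omega.
Proof.
move=> rhod sigmad omegad; apply: Dout_le_purification => //.
by apply: purifP; exact: ptrace2_density.
Qed.

Lemma Fout_ninfty rho sigma omega :
  density rho -> density sigma -> density omega -> Fout rho sigma omega != -oo.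
Proof. by move=> *; apply: Dout_ninfty => //; exact: purif_density. Qed.

Lemma Fout_convex (X : finType) (p : X -> R) rho (sigma omega : X -> op R E) :
  (forall x, 0 <= p x)%R -> (\sum_x p x = 1)%R -> density rho ->
  (forall x, density (sigma x)) -> (forall x, density (omega x)) ->
  Fout rho (mixture p sigma) (mixture p omega) <=
  \sum_x (p x)%:E * Fout rho (sigma x) (omega x).
Proof. by move=> *; apply: Dout_convex => //; exact: purif_density. Qed.

(** The flagged mixture of the chosen purifications is one extension of [mixture p rho]; the chosen
    purification of the mixture dominates it. *)
Lemma Fout_concave (X : finType) (p : X -> R) (rho : X -> op R A) sigma omega :
  (forall x, 0 <= p x)%R -> (\sum_x p x = 1)%R -> (forall x, density (rho x)) ->
  density sigma -> density omega ->
  \sum_x (p x)%:E * Fout (rho x) sigma omega <= Fout (mixture p rho) sigma omega.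
Proof.
move=> p0 p1 rhod sigmad omegad.
have vd x : density (projector (purif (rho x))) by exact: purif_density.
apply: le_trans (Dout_concave p0 p1 vd sigmad omegad) _.
apply: le_trans (Dout_le_Fout _ sigmad omegad) _; first exact: flag_state_density.
rewrite ptrace2_flag_state (_ : (fun x => _) = rho) //.
by apply/funext => x; apply: purifP.
Qed.

End Purified.
End OneChannelPair.
End ChannelDivergence.

(** * Fan's minimax theorem *)

Section Minimax.
Variables (R : realType) (Y : topologicalType).
Implicit Types (K : set Y).
Local Open Scope ereal_scope.

(** Only points of [K] are tested, since a divergence is controlled only at density operators. Real
    thresholds [t] allow for the value [+oo]. *)
Definition lsc_on K (g : Y -> \bar R) :=
  forall y (t : R), K y -> t%:E < g y -> \forall y' \near y, K y' -> t%:E < g y'.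

(** Closedness is tested at points of [K] only, which is where [lsc_on] gives information. *)
Lemma compact_rel_closed (T : topologicalType) (K A : set T) : compact K -> A `<=` K ->
  (forall y, K y -> ~ A y -> \forall y' \near y, ~ A y') -> compact A.
Proof.
move=> Kc AK Acl F PF FA; have [y [Ky Fy]] := Kc F PF (filterS AK FA).
exists y; split=> //; apply: contrapT => /(Acl y Ky) nA.
by have [z [Az]] := Fy _ _ FA nA.
Qed.

(** Near each point of [K] all large integers [k] give the strict bound [- k]; compactness makes one
    [k] uniform. *)
Lemma lsc_on_bounded_below K (m : nat) (g : 'I_m -> Y -> \bar R) : compact K ->
  (forall i, lsc_on K (g i)) -> (forall i y, K y -> g i y != -oo) ->
  exists2 L : R, (0 <= L)%R & forall i y, K y -> (- L)%:E <= g i y.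
Proof.
move=> /compact_near_coveringP/near_covering_withinP Kc gl gN.
have [|k _ kP] := Kc nat \oo (fun k y => forall i, (- k%:R)%:E < g i y) _.
  move=> y Ky; suff : forall i, \forall u \near filter_prod (nbhs y) \oo,
      K u.1 -> (- u.2%:R)%:E < g i u.1.
    by move=> /filter_forall; apply: filterS => u uP Ku i; exact: uP.
  move=> i; have [k gk] : exists k : nat, (- k%:R)%:E < g i y.
    have := gN i y Ky; case: (g i y) => [r| |] // _; last by exists 0%N; rewrite ltry.
    exists (Num.bound r); rewrite lte_fin ltrNl.
    have := archi_boundP (normr_ge0 r); rewrite /Num.bound normr_id.
    by have := ler_norm (- r); rewrite normrN; lra.
  exists ([set y' | K y' -> (- k%:R)%:E < g i y'], [set l | (k <= l)%N]) => /=.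
    by split; [exact: gl|exists k].
  move=> [y' l] /= [gy' kl] Ky'; apply: le_lt_trans (gy' Ky').
  by rewrite lee_fin lerN2 ler_nat.
exists k%:R => // i y Ky; apply/ltW.
by apply: (kP k (leqnn k)).
Qed.

Lemma ereal_between (a b : \bar R) : a < b -> exists2 r : R, a < r%:E & r%:E < b.
Proof.
case: a b => [a| |] [b| |] // ab.
- by exists ((a + b) / 2)%R; rewrite !lte_fin in ab *; lra.
- by exists (a + 1)%R; rewrite ?ltry // lte_fin ltrDl.
- by exists (b - 1)%R; rewrite ?ltNyr // lte_fin ltrBlDr ltrDl.
- by exists 0%R; rewrite ?ltNyr ?ltry.
Qed.

(** The penalty [x_+ ^+ 2] has derivative [2 * x_+], with a remainder of at most [h ^+ 2]. *)
Lemma sqr_pos_part_le (x h : R) :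
  (Num.max (x + h) 0 ^+ 2 <= Num.max x 0 ^+ 2 + 2 * Num.max x 0 * h + h ^+ 2)%R.
Proof. by rewrite /Num.max; case: ltP => ?; case: ltP => ?; nra. Qed.

Lemma ge0_of_quadratic (b q : R) : (0 <= q)%R ->
  (forall t, 0 < t <= 1 -> 0 <= 2 * t * b + t ^+ 2 * q)%R -> (0 <= b)%R.
Proof.
move=> q0 bq; rewrite leNgt; apply/negP => b0.
(* For this [t], [t * q < - b], so the quadratic term cannot offset the linear one. *)
pose t := Num.min 1%R (- b / (q + 1))%R.
have q1 : (0 < q + 1)%R by lra.
have t0 : (0 < t)%R by rewrite lt_min ltr01 divr_gt0 // oppr_gt0.
have t1 : (t <= 1)%R by rewrite ge_min lexx.
have tq : (t * (q + 1) <= - b)%R by rewrite -ler_pdivlMr // ge_min lexx orbT.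
have := bq t; rewrite t0 t1 => /(_ isT); nra.
Qed.

(** On the epigraph the penalty is continuous in the heights [z], although [g] is only lower
    semicontinuous and may be infinite. The heights can be confined to a box, inside which the
    epigraph is compact. *)
Lemma penalty_minimizer K (m : nat) (g : 'I_m -> Y -> \bar R) (c : R) y0 :
  compact K -> (forall i, lsc_on K (g i)) -> (forall i y, K y -> g i y != -oo) ->
  K y0 -> (forall i, g i y0 < +oo) ->
  exists (y : Y) (z : 'I_m -> R), [/\ K y, forall i, g i y <= (z i)%:E
    & forall y' (z' : 'I_m -> R), K y' -> (forall i, g i y' <= (z' i)%:E) ->
      (\sum_i Num.max (z i - c) 0 ^+ 2 <= \sum_i Num.max (z' i - c) 0 ^+ 2)%R].
Proof.
move=> Kc gl gN Ky0 gy0.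
pose phi (z : 'I_m -> R) := (\sum_i Num.max (z i - c) 0 ^+ 2)%R.
have [L L0 gL] := lsc_on_bounded_below Kc gl gN.
pose z0 i := fine (g i y0).
have gz0 i : g i y0 = (z0 i)%:E by rewrite fineK // fin_numE gN // lt_eqF.
(* A height above [T] costs at least [(1 + phi z0) ^+ 2 >= phi z0], and [z0 i <= T] because
   [x <= 1 + x ^+ 2]. *)
pose T := (c + 1 + phi z0)%R.
have phi_ge z i : (Num.max (z i - c) 0 ^+ 2 <= phi z)%R.
  rewrite /phi (bigD1 i) //= lerDl; apply: sumr_ge0 => j _; exact: sqr_ge0.
have phi_gt z i : (T < z i -> phi z0 <= phi z)%R.
  move=> Tz; apply: le_trans (phi_ge z i).
  have phi0 : (0 <= phi z0)%R by apply: sumr_ge0 => *; exact: sqr_ge0.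
  by rewrite max_l; rewrite /T in Tz; nra.
have z0T i : (z0 i <= T)%R.
  have phi0 : (0 <= phi z0)%R by apply: sumr_ge0 => *; exact: sqr_ge0.
  have := phi_ge z0 i; rewrite /T.
  have [zc|cz] := leP (z0 i - c)%R 0%R => zphi; first lra.
  have := sqr_ge0 (z0 i - c - 1)%R; nra.
pose box : set 'rV[R]_m := [set v | forall i, `[(- L)%R, T]%classic (v ord0 i)].
pose S : set (Y * 'rV[R]_m) :=
  [set u | (K `*` box) u /\ forall i, g i u.1 <= (u.2 ord0 i)%:E].
have Sc : compact S.
  apply: (@compact_rel_closed _ (K `*` box)).
  - apply: compact_setX => //; 
    apply: (@rV_compact R m (fun=> `[(- L)%R, T]%classic)) => i.
    exact: segment_compact.
  - by move=> u [].
  - move=> [y v] [Ky vbox] nS.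
    have [i giv] : exists i, (v ord0 i)%:E < g i y.
      apply/not_existsP => gle; apply: nS; split=> // i /=.
      by rewrite leNgt; apply/negP; exact: gle.
    (* The real [r] separates the two sides on a neighbourhood, by lower semicontinuity of [g i] and
       continuity of the coordinate. *)
    have [r + rg] := ereal_between giv; rewrite lte_fin => vr.
    exists ([set y' | K y' -> r%:E < g i y'], [set v' : 'rV[R]_m | v' ord0 i < r]%R).
      split; first exact: gl.
      have cvgv : (fun v' : 'rV[R]_m => v' ord0 i) @ v --> v ord0 i.
        exact: coord_continuous.
      exact: (cvgr_lt _ cvgv _ vr).
    move=> [y' v'] /= [rgy' v'r] [[/= Ky' _] /(_ i) /= gv'].
    have := lt_le_trans (rgy' Ky') gv'; rewrite lte_fin => rv'.
    by have := lt_trans rv' v'r; rewrite ltxx.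
have [||u uS umin] := @compact_EVT_min _ _
  (fun u : Y * 'rV[R]_m => phi (fun i => u.2 ord0 i)) S _ Sc.
- exists (y0, \row_i z0 i); split=> [|i] /=; last by rewrite mxE gz0.
  split=> //= i; rewrite /= in_itv /= mxE z0T andbT.
  by have := gL i _ Ky0; rewrite gz0 lee_fin.
- apply: continuous_subspaceT; apply: continuous_big => [u|i _ u].
    exact: add_continuous.
  apply: (@continuous_comp _ _ _ (fun u : Y * 'rV[R]_m => Num.max (u.2 ord0 i - c) 0)%R
    (fun x => x ^+ 2)%R); last exact: exprn_continuous.
  apply: continuous_max; last exact: cvg_cst.
  apply: cvgB; last exact: cvg_cst.
  apply: (@continuous_comp _ _ _ snd (fun v : 'rV[R]_m => v ord0 i)).
    exact: cvg_snd.
  exact: coord_continuous.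
move: uS; rewrite inE => -[[Ku ubox] gu].
exists u.1, (fun i => u.2 ord0 i); split => // y' z' Ky' gz'.
have : (phi (fun i => u.2 ord0 i) <= phi z0)%R.
  have := umin (y0, \row_i z0 i).
  rewrite (_ : phi (fun i => (y0, \row_i z0 i).2 ord0 i) = phi z0); last first.
    by apply: eq_bigr => i _; rewrite mxE.
  apply; rewrite inE; split=> [|i] /=; last by rewrite mxE gz0.
  split=> //= i; rewrite /= in_itv /= mxE z0T andbT.
  by have := gL i _ Ky0; rewrite gz0 lee_fin.
(* Heights outside the box compete too: above [T] they cost at least [phi z0]. *)
have [[i /phi_gt Ti] le0|z'T _] := pselect (exists i, (T < z' i)%R).
  exact: le_trans le0 Ti.
have := umin (y', \row_i z' i).
rewrite (_ : phi (fun i => (y', \row_i z' i).2 ord0 i) = phi z'); last first.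
  by apply: eq_bigr => i _; rewrite mxE.
apply; rewrite inE; split=> [|i] /=; last by rewrite mxE.
split=> //= i; rewrite /= in_itv /= mxE; apply/andP; split.
  by rewrite -lee_fin; apply: le_trans (gz' i); exact: gL.
by rewrite leNgt; apply/negP => Tz; apply: z'T; exists i.
Qed.

(** Fan's notion: a point doing at least as well as the mixture exists, with no linear structure on
    [Y]. Two points suffice, as only one-dimensional variations are taken. *)
Definition convexlike_on K (X : Type) (P : set X) (f : X -> Y -> \bar R) :=
  forall y1 y2 (t : R), K y1 -> K y2 -> (0 <= t <= 1)%R ->
  exists2 y, K y & forall x, P x -> f x y <= t%:E * f x y1 + (1 - t)%:E * f x y2.

(** Mixtures of any finite size, so that all the weights of [finite_minimax] are absorbed at
    once. *)
Definition concavelike_on K (X : Type) (P : set X) (f : X -> Y -> \bar R) :=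
  forall (m : nat) (p : 'I_m -> R) (x : 'I_m -> X),
  (forall i, 0 <= p i)%R -> (\sum_i p i = 1)%R -> (forall i, P (x i)) ->
  exists2 x0, P x0 & forall y, K y -> \sum_i (p i)%:E * f (x i) y <= f x0 y.

(* The weights are the gradient of the penalty [\sum_i (z_i - c)_+^2] at its
   minimizer over the epigraph, perturbed so that all of them are positive:
   then the weighted sum is [+oo] as soon as one of the terms is. *)
Lemma finite_minimax_weights K (m : nat) (g : 'I_m -> Y -> \bar R) (c : R) :
  compact K -> (forall i, lsc_on K (g i)) -> (forall i y, K y -> g i y != -oo) ->
  convexlike_on K setT g -> (forall y, K y -> exists i, c%:E < g i y) ->
  exists2 w : 'I_m -> R, (forall i, 0 < w i)%R &
    forall y (r : 'I_m -> R), K y -> (forall i, g i y = (r i)%:E) ->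
      (c * \sum_i w i <= \sum_i w i * r i)%R.
Proof.
move=> Kc gl gN gconv gc.
have [[y0 [Ky0 gy0]]|nfin] := pselect (exists y0, K y0 /\ forall i, g i y0 < +oo);
    last first.
  (* No point of [K] has all its values finite, so the inequality is vacuous. *)
  exists (fun=> 1%R) => // y r Ky gr; case: nfin; exists y; split=> // i.
  by rewrite gr ltry.
have [y [z [Ky gz zmin]]] := penalty_minimizer c Kc gl gN Ky0 gy0.
have [L L0 gL] := lsc_on_bounded_below Kc gl gN.
pose a i := Num.max (z i - c)%R 0%R.
have a0 i : (0 <= a i)%R by rewrite le_max lexx orbT.
pose phi := (\sum_i a i ^+ 2)%R.
have [i0 zi0] : exists i, (c < z i)%R.
  by have [i gi] := gc y Ky; exists i; rewrite -lte_fin; exact: lt_le_trans (gz i).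
have phi0 : (0 < phi)%R.
  rewrite /phi (bigD1 i0) //= ltr_pwDl //; last by apply: sumr_ge0 => *; exact: sqr_ge0.
  by rewrite exprn_gt0 // /a lt_max subr_gt0 zi0.
have m0 : (0 < m%:R :> R)%R by rewrite ltr0n; exact: leq_ltn_trans (ltn_ord i0).
(* First-order condition at the minimizer: the heights [z + t * (r - z)] lie above [g] at the
   convexlike point between [y'] and [y]. *)
have grad y' (r : 'I_m -> R) : K y' -> (forall i, g i y' = (r i)%:E) ->
    (0 <= \sum_i a i * (r i - z i))%R.
  move=> Ky' gr; apply: (@ge0_of_quadratic _ (\sum_i (r i - z i) ^+ 2)%R).
    by apply: sumr_ge0 => *; exact: sqr_ge0.
  move=> t /andP[t0 t1].
  have [|u Ku gu] := gconv y' y t Ky' Ky; first by rewrite ltW.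
  have guz i : g i u <= (z i + t * (r i - z i))%:E.
    have t1' : 0 <= (1 - t)%:E :> \bar R by rewrite lee_fin subr_ge0.
    apply: le_trans (gu i I) (le_trans (leeD (lexx _) (lee_wpmul2l t1' (gz i))) _).
    by rewrite gr -!EFinM -EFinD lee_fin; lra.
  have := zmin u _ Ku guz.
  rewrite -subr_ge0 => /le_trans; apply.
  rewrite -sumrB !mulr_sumr -big_split; apply: ler_sum => i _ /=.
  have := sqr_pos_part_le (z i - c) (t * (r i - z i)); rewrite /a addrAC; lra.
(* The perturbation lowers the sum of the [w i * (r i - c)] by at most [e * m * (L + |c|)], which
   the gain [phi] covers; the [+ 1] keeps the denominator positive. *)
pose e := (phi / (m%:R * (L + `|c| + 1)))%R.
have D0 : (0 < L + `|c| + 1)%R by have := normr_ge0 c; lra.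
have e0 : (0 < e)%R by rewrite divr_gt0 // mulr_gt0.
exists (fun i => a i + e)%R => [i|y' r Ky' gr]; first exact: ltr_wpDl.
have rL i : (- L <= r i)%R by rewrite -lee_fin -gr; exact: gL.
have := grad y' r Ky' gr.
(* Since [a i * (z i - c) = a i ^+ 2], the first-order condition gives a gain of [phi] over the
   level [c]. *)
have -> : (\sum_i a i * (r i - z i) = \sum_i a i * r i - c * \sum_i a i - phi)%R.
  rewrite mulr_sumr -!sumrB; apply: eq_bigr => i _.
  by rewrite /a; case: (leP (z i - c)%R 0%R) => _; ring.
rewrite big_split /= sumr_const card_ord mulrDr.
have -> : (\sum_i (a i + e) * r i = \sum_i a i * r i + e * \sum_i r i)%R.
  by rewrite mulr_sumr -big_split; apply: eq_bigr => i _; rewrite /= mulrDl.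
have rsum : (- (m%:R * L) <= \sum_i r i)%R.
  rewrite -mulrN mulr_natl -[m in X in (X <= _)%R]card_ord -sumr_const.
  by apply: ler_sum => i _; exact: rL.
have ephi : (e * (m%:R * (L + `|c| + 1)) = phi)%R.
  by rewrite divfK // gt_eqF // mulr_gt0.
rewrite -mulr_natr => H.
have : (e * (- (m%:R * L)) <= e * \sum_i r i)%R by rewrite ler_pM2l.
have : (c * (e * m%:R) <= `|c| * (e * m%:R))%R.
  by rewrite ler_wpM2r ?ler_norm // mulr_ge0 // ltW.
have : (0 < e * m%:R)%R by rewrite mulr_gt0.
by nra.
Qed.

Lemma finite_minimax K (m : nat) (g : 'I_m -> Y -> \bar R) (c : R) :
  compact K -> K !=set0 ->
  (forall i, lsc_on K (g i)) -> (forall i y, K y -> g i y != -oo) ->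
  convexlike_on K setT g -> (forall y, K y -> exists i, c%:E < g i y) ->
  exists p : 'I_m -> R, [/\ (forall i, 0 <= p i)%R, (\sum_i p i = 1)%R &
    forall y, K y -> c%:E <= \sum_i (p i)%:E * g i y].
Proof.
move=> Kc [y0 Ky0] gl gN gconv gc.
have [w w0 wP] := finite_minimax_weights Kc gl gN gconv gc.
have [i0 _] := gc y0 Ky0.
have W0 : (0 < \sum_i w i)%R.
  by rewrite (bigD1 i0) //= ltr_pwDl //; apply: sumr_ge0 => *; exact: ltW.
have p0 i : (0 < w i / \sum_j w j)%R by rewrite divr_gt0.
exists (fun i => w i / \sum_j w j)%R; split=> [i||y Ky]; first exact: ltW.
  by rewrite -mulr_suml divff // gt_eqF.
have [[i giy]|gfin] := pselect (exists i, g i y = +oo).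
  suff -> : \sum_i (w i / \sum_j w j)%:E * g i y = +oo by rewrite leey.
  apply/esum_eqyP => [j _|].
    rewrite mule_eq_ninfty negb_or !negb_or !negb_and gN //= orbT /=.
    by rewrite lte_fin -leNgt (ltW (p0 j)).
  by exists i; rewrite mem_index_enum giy gt0_muley ?lte_fin.
pose r i := fine (g i y).
have gr i : g i y = (r i)%:E.
  rewrite fineK // fin_numE gN //=; apply/eqP => giy; apply: gfin.
  by exists i.
under eq_bigr do rewrite gr -EFinM.
rewrite sumEFin lee_fin; under eq_bigr do rewrite mulrAC.
by rewrite -mulr_suml ler_pdivlMr //; exact: (wP y r Ky gr).
Qed.

(** If a real [c] separated the two sides, finitely many of the sets where [c < f x] would cover
    [K]. The finite case gives a mixture that is at least [c] on [K], and concavity a single [x0]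
    contradicting the choice of [c]. *)
Lemma minimax_le K (X : eqType) (P : set X) (f : X -> Y -> \bar R) :
  compact K -> K !=set0 ->
  (forall x, P x -> lsc_on K (f x)) -> (forall x y, P x -> K y -> f x y != -oo) ->
  convexlike_on K P f -> concavelike_on K P f ->
  ereal_inf [set ereal_sup [set f x y | x in P] | y in K] <=
  ereal_sup [set ereal_inf [set f x y | y in K] | x in P].
Proof.
move=> Kc K0 fl fN fconv fconc; rewrite leNgt.
apply/negP => /ereal_between[c supc cinf].
have fc y : K y -> exists2 x, P x & c%:E < f x y.
  move=> Ky; have /ereal_sup_gt[_ [x Px <-] cf] : c%:E < ereal_sup [set f x y | x in P].
    by apply: lt_le_trans cinf _; apply: ereal_inf_lbound; exists y.
  by exists x.
(* Finite sequences directed by inclusion: near covering along this filter extracts a finite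
   subcover. *)
pose F := filter_from [set: seq X] (fun s0 => [set s : seq X | {subset s0 <= s}]).
have FF : Filter F.
  apply: filter_from_filter => [|s1 s2 _ _]; first by exists [::].
  exists (s1 ++ s2) => // s s12; split=> x xs; apply: s12; rewrite mem_cat xs ?orbT //.
have /compact_near_coveringP/near_covering_withinP := Kc.
move=> /(_ _ F (fun s y => exists x, [/\ x \in s, P x & c%:E < f x y]) FF)[|s0 _ s0P].
  move=> y Ky; have [x Px cf] := fc y Ky.
  exists ([set y' | K y' -> c%:E < f x y'], [set s : seq X | x \in s]).
    split; first exact: fl.
    by exists [:: x] => // s; apply; rewrite mem_head.
  by move=> [y' s] /= [cf' xs] Ky'; exists x; split => //; exact: cf'.
(* The sequence [s0] may contain points outside [P]. *)
pose s := [seq x <- s0 | `[< P x >]].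
have xP (i : 'I_(size s)) : P (tnth (in_tuple s) i).
  by have := mem_tnth i (in_tuple s); rewrite mem_filter => /andP[/asboolP].
pose g (i : 'I_(size s)) := f (tnth (in_tuple s) i).
have gl i : lsc_on K (g i) by exact: fl.
have gN i y : K y -> g i y != -oo by exact: fN.
have gconv : convexlike_on K setT g.
  move=> y1 y2 t Ky1 Ky2 t01; have [y Ky yP] := fconv y1 y2 t Ky1 Ky2 t01.
  by exists y => // i _; exact: yP.
have gc y : K y -> exists i, c%:E < g i y.
  move=> Ky; have [x [xs0 Px cf]] : exists x, [/\ x \in s0, P x & c%:E < f x y].
    by apply: (s0P s0 _ y Ky) => x.
  have /tnthP[i xi] : x \in in_tuple s by rewrite mem_filter xs0 andbT; exact/asboolP.
  by exists i; rewrite /g -xi.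
have [p [p0 p1 pc]] := finite_minimax Kc K0 gl gN gconv gc.
have [x0 Px0 x0P] := fconc _ p _ p0 p1 xP.
have : c%:E <= ereal_sup [set ereal_inf [set f x y | y in K] | x in P].
  apply: le_ereal_sup_tmp; exists (ereal_inf [set f x0 y | y in K]); first by exists x0.
  apply: le_ereal_inf_tmp => _ [y Ky <-].
  exact: le_trans (pc y Ky) (x0P y Ky).
by rewrite leNgt supc.
Qed.

End Minimax.

(** * Compactness of the set of density operators *)

Section DensityTopology.
Variable R : realType.
Local Notation C := (Cplx R).

Lemma mx_continuous (T : topologicalType) (m n : nat) (f : T -> 'M[C]_(m, n)) :
  (forall i j, continuous (fun x => f x i j)) -> continuous f.
Proof.
move=> fcont x A [P Pnbhs PA]; apply: filterS PA _.
apply: filter_forall => i; apply: filter_forall => j.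
exact: (fcont i j x).
Qed.

(** This form covers the trace, the quadratic forms at a fixed vector and the entries of a linear
    map. *)
Lemma bilinear_continuous (I : finType) (k : I -> I -> C) :
  continuous (fun X : op R I => \sum_i \sum_j ent X i j * k i j).
Proof.
apply: continuous_big => [u|i _]; first exact: add_continuous.
apply: continuous_big => [u|j _ X]; first exact: add_continuous.
exact: (cvgMr_tmp (@coord_continuous C _ _ (enum_rank i) (enum_rank j) X)).
Qed.

Lemma linear_fun_continuous (I J : finType) (Phi : op R I -> op R J) :
  linear Phi -> continuous Phi.
Proof.
move=> lin; apply: mx_continuous => i j.
rewrite (_ : (fun X => Phi X i j) = fun X => \sum_k \sum_k' ent X k k' *
    ent (Phi (ketbra R k k')) (enum_val i) (enum_val j)); last first.
  by apply/funext => X; rewrite -linear_fun_ent // /ent !enum_valK.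
exact: bilinear_continuous.
Qed.

Lemma norm_real_complex (x : R) : `|x%:C%C : C| = `|x|%:C%C.
Proof. by rewrite normc_def /= expr0n addr0 sqrtr_sqr. Qed.

Lemma real_complex_continuous : continuous (fun x : R => x%:C%C : C).
Proof.
move=> x; apply/cvgrPdist_lt => e e0.
have eE : e = (complex.Re e)%:C%C by rewrite RRe_real // gtr0_real.
have e'0 : 0 < complex.Re e by rewrite -ltcR -eE.
near=> y; rewrite -rmorphB /= norm_real_complex eE ltcR.
by near: y; exact: cvgr_dist_lt.
Unshelve. all: end_near. Qed.

Lemma closed_cplx_set1 (z : C) : closed [set z].
Proof. exact/accessible_closed_set1/hausdorff_accessible/norm_hausdorff. Qed.

Lemma closed_nneg : closed [set z : C | 0 <= z].
Proof.
have -> : [set z : C | 0 <= z] = (fun z : C => `|z| - z) @^-1` [set 0].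
  by apply/seteqP; split=> z /=; rewrite ger0_def -subr_eq0 => /eqP.
apply: closed_comp; last exact: closed_cplx_set1.
move=> z _; apply: (@cvgB _ _ _ _ (nbhs_filter z)); last exact: cvg_id.
exact: (@norm_continuous _ C^o).
Qed.

Lemma not_closed_near (T : topologicalType) (f : T -> C) (S : set C) x :
  continuous f -> closed S -> ~ S (f x) -> \forall x' \near x, ~ S (f x').
Proof.
move=> fc Scl nS; have := fc x (~` S); apply.
by apply: open_nbhs_nbhs; split=> //; exact: closed_openC.
Qed.

(** With [X] the Gram matrix of the rows of [Y], each term satisfies [2 * |Y i t| * |Y j t| <= |Y i
    t| ^+ 2 + |Y j t| ^+ 2], and each row has squared norm at most the trace. *)
Lemma density_bounded (I : finType) (X : op R I) i j : density X -> `|X i j| <= 1.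
Proof.
move=> [/psd_gram[Y XE] X1].
have entE k l : X k l = ent X (enum_val k) (enum_val l) by rewrite /ent !enum_valK.
pose q k : C := \sum_t `|Y k t| ^+ 2.
have q0 k : 0 <= q k by apply: sumr_ge0 => t _; exact: exprn_ge0.
have q1 k : q k <= 1.
  have := X1; rewrite mxtrace_ent (bigD1 k) //= => <-.
  rewrite XE (eq_bigr (fun t => `|Y k t| ^+ 2)) => [|t _]; last by rewrite normCK.
  rewrite lerDl; apply: sumr_ge0 => l _; rewrite XE.
  by apply: sumr_ge0 => t _; rewrite -normCK exprn_ge0.
suff : `|X i j| *+ 2 <= q (enum_val i) + q (enum_val j).
  move=> Xq; rewrite -(ler_pMn2r (isT : (0 < 2)%N)); apply: le_trans Xq _.
  by rewrite mulr2n lerD.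
rewrite entE XE -big_split /=; apply: le_trans (ler_wMn2r _ (ler_norm_sum _ _ _)) _.
rewrite -sumrMnl; apply: ler_sum => t _; rewrite normrM norm_conjC.
rewrite -subr_ge0 addrAC -sqrrB -real_normK ?exprn_ge0 //.
Qed.

Lemma compact_density (I : finType) : compact (@density R I).
Proof.
(* Compactness in [C] comes from the real square; [disc] is its image, which contains the unit
   disc. *)
pose square (z : R * R) : C := z.1%:C%C + 'i * z.2%:C%C.
pose disc : set C := square @` (`[-1, 1]%classic `*` `[-1, 1]%classic).
have squarec : continuous square.
  move=> z; apply: (@cvgD _ _ _ _ (nbhs_filter z)).
    apply: (@continuous_comp _ _ _ fst (fun x : R => x%:C%C : C)); first exact: cvg_fst.
    exact: real_complex_continuous.
  apply: (@cvgMl_tmp _ _ _ (nbhs_filter z)).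
  apply: (@continuous_comp _ _ _ snd (fun x : R => x%:C%C : C)); first exact: cvg_snd.
  exact: real_complex_continuous.
have discc : compact disc.
  apply: continuous_compact; first exact: continuous_subspaceT.
  by apply: compact_setX; exact: segment_compact.
have disc1 (z : C) : `|z| <= 1 -> disc z.
  move=> z1; exists (complex.Re z, complex.Im z); last first.
    by rewrite /square /= complexRe complexIm -Crect.
  split; rewrite /= in_itv /= -ler_norml -lecR; apply: le_trans z1.
    exact: normc_ge_Re.
  have := normc_ge_Re (z * 'i%C); rewrite ReiNIm normrN normrM => /le_trans; apply.
  by rewrite complexiE normCi mulr1.
pose box := [set X : op R I | forall i j, disc (X i j)].
have boxc : compact box.
  have -> : box = vec_mx @` [set v : 'rV[C]_(#|{: I}| * #|{: I}|) |
      forall k, disc (v ord0 k)].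
    apply/seteqP; split=> [X Xd|_ [v vd <-] i j]; last by rewrite mxE.
    exists (mxvec X); rewrite ?mxvecK // => k.
    by case/mxvec_indexP: k => i j; rewrite mxvecE.
  apply: continuous_compact; last by apply: (@rV_compact _ _ (fun=> disc)).
  apply: continuous_subspaceT; apply: mx_continuous => i j v.
  rewrite /continuous_at mxE.
  under eq_fun do rewrite mxE.
  exact: coord_continuous.
apply: (compact_rel_closed boxc) => [X Xd i j|X _ nX].
  by apply: disc1; exact: density_bounded.
(* A non-density operator has the wrong trace or a form that is not nonnegative at some vector; both
   failures persist nearby. *)
have [/psdP Xpsd|Xpsd] := pselect (psd X).
  have : ~ [set (1 : C)] (\sum_i \sum_j ent X i j * (j == i)%:R).
    move=> /= X1; apply: nX; split; first exact/psdP.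
    by rewrite mxtrace_ent -X1; apply: eq_bigr => i _; rewrite sum_deltar.
  move=> /(not_closed_near (@bilinear_continuous I _)).
  move=> /(_ (@closed_cplx_set1 _)).
  apply: filterS => X' /= nX' [_ X'1]; apply: nX'.
  by rewrite -[RHS]X'1 mxtrace_ent; apply: eq_bigr => i _; rewrite sum_deltar.
have [f nf] : exists f : I -> C,
    ~ [set z : C | 0 <= z] (\sum_i \sum_j ent X i j * ((f i)^* * f j)).
  apply/not_existsP => fX; apply: Xpsd; apply/psdP => f.
  have /contrapT /= := fX f.
  by under eq_bigr do under eq_bigr do rewrite mulrCA mulrA.
have := not_closed_near (@bilinear_continuous I _) closed_nneg nf.
apply: filterS => X' /= nX' [/psdP/(_ f) X'psd _]; apply: nX'.
by under eq_bigr do under eq_bigr do rewrite mulrCA mulrA.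
Qed.

Lemma output_linear (A E B K : finType) (Phi : op R (A * E)%type -> op R B)
    (rho : op R (A * K)%type) : linear Phi -> linear (output Phi rho).
Proof.
move=> lin a sigma tau; apply: op_ext => -[b k] [b' k'].
rewrite entD entZ !ent_output // mulr_sumr -big_split; apply: eq_bigr => p _.
rewrite mulr_sumr -big_split; apply: eq_bigr => q _ /=.
by rewrite entD entZ; ring.
Qed.

(** Outputs depend linearly, hence continuously, on each of [sigma] and [omega], and they stay in
    the domain of the divergence. *)
Lemma Dout_lsc (D : functional R) (A E B K : finType)
    (N M : op R (A * E)%type -> op R B) (rho : op R (A * K)%type) :
  lsc_divergence D -> CPTP N -> CP M -> density rho ->
  @lsc_on R (op R E * op R E)%type (@density R E `*` @density R E)
    (fun y => Dout D N M rho y.1 y.2).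
Proof.
move=> Dlsc Nc Mc rhod y t Ky ty.
have [|V] := Dlsc (B * K)%type (output N rho y.1, output M rho y.2) t; first exact: ty.
have domP y' : (@density R E `*` @density R E) y' ->
    divergence_domain (output N rho y'.1, output M rho y'.2).
  move=> [d1 d2]; split; first exact: output_density.
  by apply: output_psd => //; [case: rhod|case: d2].
move=> Vnbhs VD.
(* At a point of the domain, subspace neighbourhoods are traces of ambient ones. *)
have {}Vnbhs : within (@divergence_domain R _)
    (nbhs (output N rho y.1, output M rho y.2)) V.
  by rewrite nbhs_subspace_in //; exact: domP.
have cN : (fun y' : op R E * op R E => output N rho y'.1) @ y --> output N rho y.1.
  apply: (@continuous_comp _ _ _ fst (output N rho)); first exact: cvg_fst.
  by apply: (linear_fun_continuous (output_linear rho _)); case: Nc => -[].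
have cM : (fun y' : op R E * op R E => output M rho y'.2) @ y --> output M rho y.2.
  apply: (@continuous_comp _ _ _ snd (output M rho)); first exact: cvg_snd.
  by apply: (linear_fun_continuous (output_linear rho _)); case: Mc.
have := @cvg_pair _ _ _ _ _ _ (nbhs_filter _) (nbhs_filter _) (nbhs_filter _)
  _ _ cN cM _ Vnbhs.
apply: (@filterS _ _ (nbhs_filter y)) => y' /= y'V Ky'.
exact: VD (y'V (domP _ Ky')).
Qed.

End DensityTopology.

(** * Minimax and symmetrization *)

Section MinimaxChannelDivergence.
Variables (R : realType) (D : functional R).
Hypotheses (D_div : quantum_divergence D) (D_lsc : lsc_divergence D).
Hypothesis (D_sum : direct_sum_property D).
Local Open Scope ereal_scope.

Lemma ketbra_density (I : finType) (i : I) : density (ketbra R i i).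
Proof.
split; last first.
  rewrite mxtrace_ent; under eq_bigr do rewrite ent_ketbra.
  by rewrite sum_deltal eqxx.
apply: (@gram_psd _ _ unit (fun j _ => (j == i)%:R)) => j k.
by rewrite ent_ketbra big_const card_unit /= addr0 conjC_nat.
Qed.

Section Minimax.
Variables (A E B : finType) (N M : op R (A * E)%type -> op R B).
Hypotheses (E_gt0 : (0 < #|E|)%N) (N_cptp : CPTP N) (M_cp : CP M).
Variable purif : op R A -> ket R (A * A)%type.
Hypothesis purifP : forall rho, density rho -> purifies (purif rho) rho.
Local Notation F := (Fout D N M purif).

(** The direction that uses Fan's theorem. The pair [(sigma, omega)] is treated as one point, so
    that joint convexity is the convexity required. *)
Lemma minimax_le_divergence :
  ereal_inf [set ereal_sup [set F rho sigma omega | rho in @density R A]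
            | sigma in @density R E & omega in @density R E] <=
  minimax_divergence D N M.
Proof.
pose Y := (op R E * op R E)%type.
pose K : set Y := @density R E `*` @density R E.
pose f rho (y : Y) := F rho y.1 y.2.
have K0 : K !=set0.
  have [e _] := card_gt0P E_gt0.
  by exists (ketbra R e e, ketbra R e e); split; exact: ketbra_density.
have Kc : compact K by apply: compact_setX; exact: compact_density.
have fl rho : density rho -> lsc_on K (f rho).
  by move=> rhod; apply: Dout_lsc => //; exact: purif_density.
have fN rho y : density rho -> K y -> f rho y != -oo.
  by move=> rhod [y1d y2d]; exact: Fout_ninfty.
have fconv : convexlike_on K (@density R A) f.
  move=> y1 y2 t [y1d y1d'] [y2d y2d'] /andP[t0 t1].
  pose p (b : bool) : R := if b then t else (1 - t)%R.
  pose s (b : bool) := if b then y1.1 else y2.1.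
  pose w (b : bool) := if b then y1.2 else y2.2.
  have p0 b : (0 <= p b)%R by case: b => //=; rewrite subr_ge0.
  have p1 : (\sum_b p b = 1)%R by rewrite big_bool /= addrC subrK.
  have sd b : density (s b) by case: b.
  have wd b : density (w b) by case: b.
  exists (mixture p s, mixture p w); first by split; exact: mixture_density.
  move=> rho rhod; have := Fout_convex D_div D_sum N_cptp M_cp purifP p0 p1 rhod sd wd.
  by rewrite big_bool.
have fconc : concavelike_on K (@density R A) f.
  move=> m p rho p0 p1 rhod; exists (mixture p rho); first exact: mixture_density.
  by move=> y [y1d y2d]; exact: Fout_concave.
apply: le_trans (le_trans _ (minimax_le Kc K0 fl fN fconv fconc)) _.
  apply: le_ereal_inf_tmp => _ [[s w] [sd wd] <-].
  by apply: ereal_inf_lbound; exists s => //; exists w.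
apply: ge_ereal_sup => _ [rho rhod <-].
apply: le_ereal_sup_tmp; exists (ereal_inf [set f rho y | y in K]) => //.
(* [A] itself serves as the reference system. *)
exists A, (projector (purif rho)); split; first exact: purif_density.
congr ereal_inf; apply/seteqP; split=> [_ [[s w] [sd wd] <-]|_ [s sd [w wd <-]]].
  by exists s => //; exists w.
by exists (s, w).
Qed.

(** Weak duality survives restricting the pairs to any [P], and so applies directly to invariant
    states. *)
Lemma divergence_le_minimax (P : set (op R E)) : P `<=` @density R E ->
  minimax_divergence D N M <=
  ereal_inf [set ereal_sup [set F rho sigma omega | rho in @density R A]
            | sigma in P & omega in P].
Proof.
move=> Pd; apply: le_ereal_inf_tmp => _ [sigma sigmaP [omega omegaP <-]].
apply: ge_ereal_sup => _ [K [rho [rhod ->]]].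
have sigmad := Pd _ sigmaP; have omegad := Pd _ omegaP.
apply: (@le_trans _ _ (Dout D N M rho sigma omega)).
  by apply: ereal_inf_lbound; exists sigma => //; exists omega.
apply: le_trans (Dout_le_Fout D_div N_cptp M_cp purifP rhod sigmad omegad) _.
by apply: ereal_sup_ubound; exists (ptrace2 rho) => //; exact: ptrace2_density.
Qed.

End Minimax.

(** * Averaging over the symmetric group *)

Section Symmetrization.
Variables (n : nat) (A E B : finType) (N M : op R (A * E)%type -> op R B).
Hypotheses (N_cptp : CPTP N) (M_cp : CP M).
Variable purif : op R (copies n A) -> ket R (copies n A * copies n A)%type.
Hypothesis purifP : forall rho, density rho -> purifies (purif rho) rho.
Local Notation Nn := (@tensor_pow R n A E B N).
Local Notation Mn := (@tensor_pow R n A E B M).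
Local Notation F := (Fout D Nn Mn purif).

Let Nn_cptp : CPTP Nn := tensor_pow_CPTP n N_cptp.
Let Mn_cp : CP Mn := tensor_pow_CP n M_cp.

Lemma relabel_permfK (I : finType) (s : 'S_n) (X : op R (copies n I)) :
  relabel (permf s^-1) (relabel (permf s) X) = X.
Proof. by apply: op_ext => x y; rewrite !ent_mkop !permfKV. Qed.

Lemma relabel_permf_density (I : finType) (s : 'S_n) (X : op R (copies n I)) :
  density X -> density (relabel (permf s) X).
Proof. by apply: relabel_density; exact: permf_bij. Qed.

(** Permuting only the [A] side of the chosen purification purifies the permuted state, though
    possibly not by the chosen vector. Applied to [s] and to its inverse, the inequality is an
    equality. *)
Lemma Fout_perm (s : 'S_n) rho sigma omega :
  density rho -> density sigma -> density omega ->
  F rho sigma omega <=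
  F (relabel (permf s) rho) (relabel (permf s) sigma) (relabel (permf s) omega).
Proof.
move=> rhod sigmad omegad.
pose v := projector (purif rho).
pose v' : op R (copies n A * copies n A)%type :=
  relabel (fun p => (permf s p.1, p.2)) v.
have vd : density v by exact: purif_density.
have v'd : density v'.
  apply: relabel_density => //.
  by exists (fun p => (permf s^-1 p.1, p.2)) => -[x y] /=; rewrite ?permfK ?permfKV.
(* Covariance is used for the inverse permutation, which takes the permuted inputs back to the
   original ones. *)
have vE : v = relabel (fun p => (permf s^-1 p.1, p.2)) v'.
  by apply: op_ext => -[x y] [x' y']; rewrite !ent_mkop /= !permfKV.
have ptr : ptrace2 v' = relabel (permf s) rho by rewrite ptrace2_relabel purifP.
rewrite -ptr.
have [sd wd] := (relabel_permf_density s sigmad, relabel_permf_density s omegad).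
apply: le_trans (Dout_le_Fout D_div Nn_cptp Mn_cp purifP v'd sd wd).
rewrite /Fout -/v vE -{1}(relabel_permfK s sigma) -{1}(relabel_permfK s omega).
apply: (Dout_le_relabel D_div Nn_cptp Mn_cp) => //.
- exact: tensor_pow_perm.
- exact: tensor_pow_perm.
- exact: permf_bij.
Qed.

(** This holds for infinite [x] too: nonnegative weights distribute over any extended real. *)
Lemma sum_uniform_perm (x : \bar R) :
  \sum_(s : 'S_n) (uniform_perm R s)%:E * x = x.
Proof.
rewrite -ge0_sume_distrl => [|s _]; last by rewrite lee_fin uniform_perm_ge0.
by rewrite sumEFin uniform_perm_sum mul1e.
Qed.

Lemma le_sum_uniform_perm (f g : 'S_n -> \bar R) : (forall s, f s <= g s) ->
  \sum_s (uniform_perm R s)%:E * f s <= \sum_s (uniform_perm R s)%:E * g s.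
Proof.
move=> fg; apply: lee_sum => s _; apply: lee_wpmul2l => //.
by rewrite lee_fin uniform_perm_ge0.
Qed.

Lemma sup_symmetrize_le sigma omega : density sigma -> density omega ->
  ereal_sup [set F rho (symmetrize sigma) (symmetrize omega)
            | rho in @density R (copies n A)] <=
  ereal_sup [set F rho sigma omega | rho in @density R (copies n A)].
Proof.
move=> sigmad omegad; apply: ge_ereal_sup => _ [rho rhod <-].
apply: le_trans (Fout_convex D_div D_sum Nn_cptp Mn_cp purifP (@uniform_perm_ge0 R n)
  (uniform_perm_sum R n) rhod (fun s => relabel_permf_density s sigmad)
  (fun s => relabel_permf_density s omegad)) _.
rewrite -[leRHS]sum_uniform_perm; apply: le_sum_uniform_perm => s.
have [sd wd] := (relabel_permf_density s sigmad, relabel_permf_density s omegad).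
(* The permutation is moved from [sigma] and [omega] onto [rho], where the supremum absorbs it. *)
apply: le_trans (Fout_perm s^-1 rhod sd wd) _; rewrite !relabel_permfK.
apply: ereal_sup_ubound; exists (relabel (permf s^-1) rho) => //.
exact: relabel_permf_density.
Qed.

Lemma Fout_le_symmetrize rho sigma omega :
  density rho -> PERM sigma -> PERM omega ->
  F rho sigma omega <= F (symmetrize rho) sigma omega.
Proof.
move=> rhod /PERMP[sigmad sigmaP] /PERMP[omegad omegaP].
rewrite -[leLHS]sum_uniform_perm.
apply: le_trans (Fout_concave D_div D_sum Nn_cptp Mn_cp purifP (@uniform_perm_ge0 R n)
  (uniform_perm_sum R n) (fun s => relabel_permf_density s rhod) sigmad omegad).
apply: le_sum_uniform_perm => s.
by have := Fout_perm s rhod sigmad omegad; rewrite sigmaP omegaP.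
Qed.

Lemma sup_density_PERM sigma omega : PERM sigma -> PERM omega ->
  ereal_sup [set F rho sigma omega | rho in @density R (copies n A)] =
  ereal_sup [set F rho sigma omega | rho in @PERM R n A].
Proof.
move=> sigmaP omegaP; apply/eqP; rewrite eq_le; apply/andP; split.
  apply: ge_ereal_sup => _ [rho rhod <-].
  apply: le_trans (Fout_le_symmetrize rhod sigmaP omegaP) _.
  by apply: ereal_sup_ubound; exists (symmetrize rho) => //; exact: symmetrize_PERM.
apply: ge_ereal_sup => _ [rho [rhod _] <-].
by apply: ereal_sup_ubound; exists rho.
Qed.

End Symmetrization.
End MinimaxChannelDivergence.

Theorem lemma12 (R : realType) (D : functional R)
  (D_div : quantum_divergence D)
  (D_lsc : lsc_divergence D)
  (D_sum : direct_sum_property D)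
  (A B E : finType)
  (A_gt0 : (0 < #|A|)%N) (B_gt0 : (0 < #|B|)%N) (E_gt0 : (0 < #|E|)%N)
  (N M : op R (A * E)%type -> op R B)
  (N_cptp : CPTP N) (M_cp : CP M)
  (n : nat) (n_ge2 : (2 <= n)%N)
  (purif : op R (copies n A) -> ket R (copies n A * copies n A)%type)
  (purifP : forall rho : op R (copies n A),
     density rho -> purifies (purif rho) rho) :
  let F (rho : op R (copies n A)) (sigma omega : op R (copies n E)) : \bar R :=
    D _
      (output (@tensor_pow R n A E B N) (projector (purif rho)) sigma)
      (output (@tensor_pow R n A E B M) (projector (purif rho)) omega) in
  minimax_divergence D (@tensor_pow R n A E B N) (@tensor_pow R n A E B M) =
    ereal_inf [set ereal_sup [set F rho sigma omega
                             | rho in @density R (copies n A)]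
              | sigma in @PERM R n E & omega in @PERM R n E]
  /\
  ereal_inf [set ereal_sup [set F rho sigma omega
                           | rho in @density R (copies n A)]
            | sigma in @PERM R n E & omega in @PERM R n E] =
    ereal_inf [set ereal_sup [set F rho sigma omega
                             | rho in @PERM R n A]
              | sigma in @PERM R n E & omega in @PERM R n E].
Proof.
move=> F.
have Nn_cptp := tensor_pow_CPTP n N_cptp.
have Mn_cp := tensor_pow_CP n M_cp.
have En_gt0 : (0 < #|copies n E|)%N.
  by have [e _] := card_gt0P E_gt0; apply/card_gt0P; exists [ffun=> e].
split; last first.
  (* The two suprema already agree for each fixed invariant pair. *)
  have sup_eq := sup_density_PERM D_div D_sum N_cptp M_cp purifP.
  congr ereal_inf; apply/seteqP.
  by split=> _ [sigma sigmaP [omega omegaP <-]]; exists sigma => //;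
     exists omega => //; rewrite -/F; have := sup_eq _ _ sigmaP omegaP.
apply/eqP; rewrite eq_le; apply/andP; split.
  by apply: (divergence_le_minimax D_div Nn_cptp Mn_cp purifP) => sigma [].
apply: le_trans (minimax_le_divergence D_div D_lsc D_sum En_gt0 Nn_cptp Mn_cp purifP).
apply: le_ereal_inf_tmp => _ [sigma sigmad [omega omegad <-]].
apply: ge_ereal_inf; exists (ereal_sup [set F rho (symmetrize sigma) (symmetrize omega)
  | rho in @density R (copies n A)]).
  exists (symmetrize sigma); first exact: symmetrize_PERM.
  by exists (symmetrize omega) => //; exact: symmetrize_PERM.
exact: sup_symmetrize_le.
Qed.
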